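(* Let $\mathbb K$ be a commutative ring and $A$ a $\mathbb K$-algebra whose underlying $\mathbb K$-module is projective. Let $y\in\mathrm{NT}(A)$, let $l\geq1$ and let $z_1,\dots,z_l\in\mathscr F(A)$. Then $$y\cdot(z_1*z_2*\cdots*z_l)=\sum_{(y)}(y_{(1)}\cdot z_1)*(y_{(2)}\cdot z_2)*\cdots*(y_{(l)}\cdot z_l).$$
   Context: $\mathfrak S_n$ is the symmetric group on $\{1,\dots,n\}$ with unit $e_n$; $x_{\mathbf c}=\sum_{\sigma\in X_{\mathbf c}}\sigma$ where $X_{\mathbf c}$ is the set of permutations increasing on each block of the composition $\mathbf c$; $\sigma\times\sigma'$ is juxtaposition of permutations; standardization of a word replaces letters by $1,2,\dots$ smallest first, equal letters left to right. $\mathscr F(A)=\bigoplus_{n\ge0}\mathscr F_n(A)$, $\mathscr F_n(A)=A^{\otimes n}\otimes\mathbb K\mathfrak S_n$ with elements $(a_1\otimes\cdots\otimes a_n)\#\sigma$ and left action $\pi\cdot[(a_1\otimes\cdots\otimes a_n)\#\sigma]=[(a_{\pi^{-1}(1)}\otimes\cdots\otimes a_{\pi^{-1}(n)})\#(\pi\sigma)]$. External product: $[(a_1\otimes\cdots\otimes a_n)\#\sigma]*[(a'_1\otimes\cdots\otimes a'_{n'})\#\sigma']=x_{(n,n')}\cdot[(a_1\otimes\cdots\otimes a_n\otimes a'_1\otimes\cdots\otimes a'_{n'})\#(\sigma\times\sigma')]$. Coproduct: $\Delta((a_1\otimes\cdots\otimes a_n)\#\sigma)=\sum_{n'=0}^n[(a_1\otimes\cdots\otimes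 a_{n'})\#\pi_{n'}]\otimes[(a_{n'+1}\otimes\cdots\otimes a_n)\#\pi'_{n-n'}]$, $\pi_{n'}$ (resp. $\pi'_{n-n'}$) the inverse of the standardization of $\sigma^{-1}(1)\cdots\sigma^{-1}(n')$ (resp. $\sigma^{-1}(n'+1)\cdots\sigma^{-1}(n)$); counit the projection to $\mathscr F_0(A)=\mathbb K$. Iterated coproducts: $\Delta_1=\mathrm{id}$, $\Delta_2=\Delta$, $\Delta_l=(\Delta\otimes\mathrm{id}^{\otimes l-2})\circ\cdots\circ\Delta$, written in Sweedler notation $\Delta_l(y)=\sum_{(y)}y_{(1)}\otimes\cdots\otimes y_{(l)}$. Internal product: on $\mathscr F_n(A)$, $[(a_1\otimes\cdots\otimes a_n)\#\sigma]\cdot[(b_1\otimes\cdots\otimes b_n)\#\tau]=[(a_1b_{\sigma^{-1}(1)}\otimes\cdots\otimes a_nb_{\sigma^{-1}(n)})\#(\sigma\tau)]$, extended to $\mathscr F(A)$ by $(\sum_n\alpha_n)\cdot(\sum_n\alpha'_n)=\sum_n\alpha_n\cdot\alpha'_n$ ($\alpha_n,\alpha'_n\in\mathscr F_n(A)$). $\mathrm{TS}^n(A)\subseteq A^{\otimes n}$ is the module of $\mathfrak S_n$-invariant (symmetric) tensors, and the Novelli–Thibon algebra $\mathrm{NT}(A)$ is the subalgebra of $(\mathscr F(A),* )$ generated by all $t\#e_n$ with $t\in\mathrm{TS}^n(A)$, $n\ge0$. *)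

(* Defs.v *)
From HB Require Import structures.
From mathcomp Require Import boolp classical_sets functions cardinality fsbigop.
From mathcomp Require Import all_boot perm all_algebra.
From mathcomp Require Import generic_quotient ring_quotient.

Set Implicit Arguments.
Unset Strict Implicit.
Unset Printing Implicit Defensive.

Import GRing.Theory.
Local Open Scope quotient_scope.
Local Open Scope ring_scope.

Definition projective (K : comPzRingType) (P : lmodType K) : Prop :=
  forall (M N : lmodType K) (g : {linear M -> N}) (h : {linear P -> N}),
    (forall y, exists x, g x = y) ->
    exists k : {linear P -> M}, forall x, g (k x) = h x.

Section DirectSum.
Variables (K : comPzRingType) (I : choiceType) (V : I -> lmodType K).

Record dsum := DSum {
  dsum_val :> forall i, V i;
  dsum_finite : exists s : seq I, forall i, i \notin s -> dsum_val i = 0 }.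

HB.instance Definition _ := gen_eqMixin dsum.
HB.instance Definition _ := gen_choiceMixin dsum.

Lemma dsumP (f g : dsum) : (forall i, f i = g i) -> f = g.
Proof.
case: f g => [f hf] [g hg] /= fg.
have {}fg : f = g by apply: functional_extensionality_dep.
by subst g; rewrite (Prop_irrelevance hf hg).
Qed.

Fact dsum0_subproof : exists s : seq I, forall i, i \notin s -> 0 = 0 :> V i.
Proof. by exists [::]. Qed.
Definition dsum0 := DSum dsum0_subproof.

Fact dsumN_subproof (f : dsum) :
  exists s : seq I, forall i, i \notin s -> - f i = 0.
Proof. by have [s hs] := dsum_finite f; exists s => i /hs ->; rewrite oppr0. Qed.
Definition dsumN f := DSum (dsumN_subproof f).

Fact dsumD_subproof (f g : dsum) :
  exists s : seq I, forall i, i \notin s -> f i + g i = 0.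
Proof.
have [[s hs] [t ht]] := (dsum_finite f, dsum_finite g).
exists (s ++ t) => i; rewrite mem_cat negb_or => /andP[/hs -> /ht ->].
by rewrite addr0.
Qed.
Definition dsumD f g := DSum (dsumD_subproof f g).

Fact dsumZ_subproof (c : K) (f : dsum) :
  exists s : seq I, forall i, i \notin s -> c *: f i = 0.
Proof. by have [s hs] := dsum_finite f; exists s => i /hs ->; rewrite scaler0. Qed.
Definition dsumZ c f := DSum (dsumZ_subproof c f).

Fact dsumDA : associative dsumD.
Proof. by move=> f g h; apply: dsumP => i /=; rewrite addrA. Qed.
Fact dsumDC : commutative dsumD.
Proof. by move=> f g; apply: dsumP => i /=; rewrite addrC. Qed.
Fact dsum0D : left_id dsum0 dsumD.
Proof. by move=> f; apply: dsumP => i /=; rewrite add0r. Qed.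
Fact dsumND : left_inverse dsum0 dsumN dsumD.
Proof. by move=> f; apply: dsumP => i /=; rewrite addNr. Qed.
HB.instance Definition _ :=
  GRing.isZmodule.Build dsum dsumDA dsumDC dsum0D dsumND.

Fact dsumZA a b f : dsumZ a (dsumZ b f) = dsumZ (a * b) f.
Proof. by apply: dsumP => i /=; rewrite scalerA. Qed.
Fact dsum1Z : left_id 1 dsumZ.
Proof. by move=> f; apply: dsumP => i /=; rewrite scale1r. Qed.
Fact dsumZDr : right_distributive dsumZ +%R.
Proof. by move=> c f g; apply: dsumP => i /=; rewrite scalerDr. Qed.
Fact dsumZDl f : {morph dsumZ^~ f : a b / a + b}.
Proof. by move=> a b; apply: dsumP => i /=; rewrite scalerDl. Qed.
HB.instance Definition _ :=
  GRing.Zmodule_isLmodule.Build K dsum dsumZA dsum1Z dsumZDr dsumZDl.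

Fact dsum_in_subproof (i : I) (v : V i) :
  exists s : seq I, forall j, j \notin s -> dfwith (fun j => 0 : V j) v j = 0.
Proof.
exists [:: i] => j; rewrite inE => ji; rewrite dfwith_out //.
by rewrite eq_sym.
Qed.
Definition dsum_in (i : I) (v : V i) : dsum := DSum (dsum_in_subproof v).

(* The linear map out of the direct sum with linear components [g i]. *)
Definition dsum_lift (W : lmodType K) (g : forall i, V i -> W) (f : dsum) : W :=
  \sum_(i \in [set: I]) g i (f i).

Lemma dsum_lift_seq (W : lmodType K) (g : forall i, V i -> W) (f : dsum)
    (s : seq I) :
  (forall i, g i 0 = 0) -> (forall i, i \notin s -> f i = 0) ->
  dsum_lift g f = \sum_(i <- undup s) g i (f i).
Proof.
move=> g0 fs; rewrite /dsum_lift (fsbigE (undup s)) ?undup_uniq //; first by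
  apply: eq_bigl => i; rewrite classical_sets.in_setT.
by move=> i _; rewrite mem_undup => /fs ->.
Qed.

Lemma dsum_lift_linear (W : lmodType K) (g : forall i, V i -> W) :
  (forall i, linear (g i)) -> linear (dsum_lift g).
Proof.
move=> glin c f h; have g0 i : g i 0 = 0.
  by have:= glin i (-1) 0 0; rewrite scaler0 addr0 scaleN1r addNr.
have [[s hs] [t ht]] := (dsum_finite f, dsum_finite h).
rewrite !(dsum_lift_seq (s := s ++ t)) //=; last first.
- by move=> i; rewrite mem_cat negb_or => /andP[/hs -> /ht ->]; rewrite scaler0 addr0.
- by move=> i; rewrite mem_cat negb_or => /andP[/hs ->].
- by move=> i; rewrite mem_cat negb_or => /andP[_ /ht ->].
by rewrite scaler_sumr -big_split; apply: eq_bigr => i _; exact: glin.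
Qed.

Lemma dsum_lift_in (W : lmodType K) (g : forall i, V i -> W) (i : I) (v : V i) :
  (forall j, g j 0 = 0) -> dsum_lift g (dsum_in v) = g i v.
Proof.
move=> g0; rewrite (dsum_lift_seq (s := [:: i])) //= ?big_seq1 ?dfwith_in //.
by move=> j; rewrite inE => ji; rewrite dfwith_out // eq_sym.
Qed.

Lemma dsum_expand (f : dsum) : f = dsum_lift (@dsum_in) f.
Proof.
have [s hs] := dsum_finite f; rewrite (dsum_lift_seq (s := s)) //; last first.
  move=> i; apply: dsumP => j /=.
  by case: (eqVneq i j) => [<-|ij]; rewrite ?dfwith_in ?dfwith_out.
apply: dsumP => i.
have E : {morph (fun f : dsum => f i) : x y / x + y} by [].
rewrite (big_morph _ E (erefl : (0 : dsum) i = 0)).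
case: (boolP (i \in s)) => si; last first.
  rewrite hs // big1_seq // => j; rewrite mem_undup => /= sj.
  by rewrite dfwith_out //; apply: contraNneq si => <-.
rewrite (bigD1_seq i) ?mem_undup ?undup_uniq //= dfwith_in big1 ?addr0 // => j ji.
by rewrite dfwith_out.
Qed.

End DirectSum.
Arguments dsum_in {K I} V i v.

Section QuotientModule.
Variables (K : comPzRingType) (M : lmodType K) (R : M -> Prop).

Definition generated_submod (x : M) : Prop :=
  forall S : {pred M}, submod_closed S -> (forall r, R r -> r \in S) -> x \in S.

Definition generated_submod_pred : {pred M} := fun x => `[< generated_submod x >].

Fact generated_submod_closed : submod_closed generated_submod_pred.
Proof.
split=> [|c x y /asboolP Sx /asboolP Sy]; apply/asboolP => S SS RS.
  by case: SS.
by case: (SS) => _; apply; [apply: Sx | apply: Sy].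
Qed.
HB.instance Definition _ :=
  GRing.isZmodClosed.Build M generated_submod_pred
    (GRing.submod_closedB generated_submod_closed).

Definition lquot := Quotient.quot generated_submod_pred.
HB.instance Definition _ := GRing.Zmodule.on lquot.
HB.instance Definition _ := EqQuotient.on lquot.

Lemma lquot_eqP (x y : M) :
  \pi_lquot x = \pi_lquot y <-> generated_submod (x - y).
Proof.
have e : (x - y \in generated_submod_pred) = (\pi_lquot x == \pi_lquot y).
  exact: Quotient.idealrBE.
by split=> [/eqP|xy]; [rewrite -e => /asboolP | apply/eqP; rewrite -e; apply/asboolP].
Qed.

Definition lquotZ (c : K) (x : lquot) : lquot := \pi_lquot (c *: repr x).

Lemma lquotZ_pi (c : K) (x : M) : lquotZ c (\pi_lquot x) = \pi_lquot (c *: x).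
Proof.
apply/lquot_eqP; rewrite -scalerBr => S SS RS.
have: generated_submod (repr (\pi_lquot x) - x) by apply/lquot_eqP; rewrite reprK.
move=> /(_ S SS RS) xS; case: SS => S0 SS.
by rewrite -[_ *: _]addr0 SS.
Qed.

Lemma lquotD_pi (x y : M) : \pi_lquot x + \pi_lquot y = \pi_lquot (x + y).
Proof. exact: esym (Quotient.pi_add (generated_submod_pred : zmodClosed M) x y). Qed.

Lemma lquot0_pi : \pi_lquot 0 = 0.
Proof. by apply: (addrI (\pi_lquot 0)); rewrite addr0 lquotD_pi addr0. Qed.

Fact lquotZA a b x : lquotZ a (lquotZ b x) = lquotZ (a * b) x.
Proof. by rewrite -[x]reprK [lquotZ b _]lquotZ_pi !lquotZ_pi scalerA. Qed.
Fact lquot1Z : left_id 1 lquotZ.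
Proof. by move=> x; rewrite -[x]reprK !lquotZ_pi scale1r. Qed.
Fact lquotZDr : right_distributive lquotZ +%R.
Proof.
move=> c x y; rewrite -[x]reprK -[y]reprK lquotD_pi !lquotZ_pi scalerDr.
by rewrite lquotD_pi.
Qed.
Fact lquotZDl x : {morph lquotZ^~ x : a b / a + b}.
Proof.
by move=> a b; rewrite -[x]reprK !lquotZ_pi lquotD_pi scalerDl.
Qed.
HB.instance Definition _ :=
  GRing.Zmodule_isLmodule.Build K lquot lquotZA lquot1Z lquotZDr lquotZDl.

End QuotientModule.

Section TensorPower.
Variables (K : comPzRingType) (V : lmodType K) (n : nat).
Implicit Types (a : {ffun 'I_n -> V}) (i : 'I_n).

Definition ffset a i (v : V) : {ffun 'I_n -> V} :=
  [ffun j => if j == i then v else a j].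

Definition multilinear (W : lmodType K) (f : {ffun 'I_n -> V} -> W) : Prop :=
  forall a i, linear (fun v => f (ffset a i v)).

Definition tens_free : lmodType K := dsum (fun _ : {ffun 'I_n -> V} => K^o).
Definition tens_gen a : tens_free := dsum_in (fun=> K^o) a 1.

Variant tens_relator : tens_free -> Prop :=
  TensRelator a i (c : K) (u v : V) : tens_relator
    (tens_gen (ffset a i (c *: u + v))
     - (c *: tens_gen (ffset a i u) + tens_gen (ffset a i v))).

Definition tens : lmodType K := lquot tens_relator.
Definition tpure a : tens := \pi_(lquot tens_relator) (tens_gen a).

Lemma tpure_multilinear : multilinear tpure.
Proof.
move=> a i c u v; rewrite -[c *: tpure _]/(lquotZ c _) lquotZ_pi.
rewrite [RHS]lquotD_pi; apply/lquot_eqP => S _; apply.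
exact: TensRelator.
Qed.

Definition free_lift (W : lmodType K) (f : {ffun 'I_n -> V} -> W) :
    tens_free -> W :=
  dsum_lift (fun a (c : K^o) => (c : K) *: f a).

(* The linear map [tens -> W] induced by a multilinear [f]; see [tlift_pure] and
   [tlift_linear]. It is meaningless when [f] is not multilinear. *)
Definition tlift (W : lmodType K) (f : {ffun 'I_n -> V} -> W) (t : tens) : W :=
  free_lift f (repr (t : lquot tens_relator)).

Lemma free_lift_linear (W : lmodType K) (f : {ffun 'I_n -> V} -> W) :
  linear (free_lift f).
Proof.
by apply: dsum_lift_linear => a c x y; rewrite scalerDl -scalerA.
Qed.

Lemma free_lift_gen (W : lmodType K) (f : {ffun 'I_n -> V} -> W) a :
  free_lift f (tens_gen a) = f a.
Proof. by rewrite /free_lift dsum_lift_in ?scale1r // => b; rewrite scale0r. Qed.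

Lemma tlift_pi (W : lmodType K) (f : {ffun 'I_n -> V} -> W) x :
  multilinear f -> tlift f (\pi_(lquot tens_relator) x) = free_lift f x.
Proof.
move=> mf; apply/eqP; rewrite -subr_eq0.
have lin := free_lift_linear f.
have l0 : free_lift f 0 = 0.
  by have:= lin (-1) 0 0; rewrite scaler0 addr0 scaleN1r addNr.
have subE y z : free_lift f y - free_lift f z = free_lift f (y - z).
  by rewrite [y - z]addrC -[- z]scaleN1r lin scaleN1r addrC.
rewrite [tlift _ _]/(free_lift f _) subE.
have : generated_submod tens_relator (repr (\pi_(lquot tens_relator) x) - x).
  by apply/lquot_eqP; rewrite reprK.
apply: (_ : _ -> _ \in [pred z | free_lift f z == 0]) => /(_ _); apply.
  split=> [|c y z]; rewrite !inE ?l0 // => /eqP y0 /eqP z0.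
  by rewrite lin y0 z0 scaler0 addr0.
move=> _ [a i c u v]; rewrite inE -subE !free_lift_gen lin !free_lift_gen.
by rewrite (mf a i c u v) subrr.
Qed.

Lemma tlift_pure (W : lmodType K) (f : {ffun 'I_n -> V} -> W) a :
  multilinear f -> tlift f (tpure a) = f a.
Proof. by move=> mf; rewrite tlift_pi // free_lift_gen. Qed.

Lemma tlift_linear (W : lmodType K) (f : {ffun 'I_n -> V} -> W) :
  multilinear f -> linear (tlift f).
Proof.
move=> mf c x y; rewrite -[x]reprK -[y]reprK -[c *: _]/(lquotZ c _) lquotZ_pi.
rewrite [X in tlift f X]lquotD_pi !tlift_pi //; exact: free_lift_linear.
Qed.

Lemma tens_span (t : tens) :
  exists (s : seq {ffun 'I_n -> V}) (c : {ffun 'I_n -> V} -> K),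
    t = \sum_(a <- s) c a *: tpure a.
Proof.
have [s hs] := dsum_finite (repr (t : lquot tens_relator) : tens_free).
exists (undup s), (fun a => (repr (t : lquot tens_relator) : tens_free) a).
rewrite -[LHS](reprK (t : lquot tens_relator)).
set x : tens_free := repr _ in hs *.
rewrite [X in \pi_ _ X](dsum_expand x) (dsum_lift_seq (s := s)) //; last first.
  move=> a; apply: dsumP => b /=.
  by case: (eqVneq a b) => [<-|ab]; rewrite ?dfwith_in ?dfwith_out.
elim: (undup s) => [|a r IH]; rewrite ?big_nil ?big_cons.
  by rewrite lquot0_pi.
rewrite -IH -[_ *: tpure _]/(lquotZ _ _) lquotZ_pi [RHS]lquotD_pi.
congr (\pi_ _ (_ + _)); apply: dsumP => b /=.
by case: (eqVneq a b) => [<-|ab]; rewrite ?dfwith_in ?dfwith_out ?[RHS]mulr1 ?[RHS]mulr0.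
Qed.

End TensorPower.

Section Permutations.

(* The composite [s \o t]; the product of [{perm T}] composes the other way. *)
Definition scomp n (s t : 'S_n) : 'S_n := (t * s)%g.

Lemma scompE n (s t : 'S_n) i : scomp s t i = s (t i).
Proof. by rewrite permM. Qed.

Definition juxt_fun n m (s : 'S_n) (t : 'S_m) (i : 'I_(n + m)) : 'I_(n + m) :=
  match split i with
  | inl j => lshift m (s j)
  | inr j => rshift n (t j)
  end.

Fact juxt_inj n m (s : 'S_n) (t : 'S_m) : injective (juxt_fun s t).
Proof.
move=> i j; rewrite /juxt_fun.
case: (splitP i) => i' ei; case: (splitP j) => j' ej /(congr1 val) /= e;
  apply: val_inj => /=.
- by rewrite ei ej; congr val; apply: (@perm_inj _ s); apply: val_inj.
- by have := ltn_ord (s i'); rewrite e ltnNge leq_addr.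
- by have := ltn_ord (s j'); rewrite -e ltnNge leq_addr.
- rewrite ei ej; congr (_ + val _)%N; apply: (@perm_inj _ t); apply: val_inj.
  exact: addnI e.
Qed.
Definition juxt n m (s : 'S_n) (t : 'S_m) : 'S_(n + m) := perm (@juxt_inj n m s t).

(* [X_(n, m)]; its sum in the group algebra is [x_(n, m)]. *)
Definition shuffles n m : {set 'S_(n + m)} :=
  [set s : 'S_(n + m) | [forall i : 'I_(n + m), forall j : 'I_(n + m),
     ((i < j)%N && ((i < n)%N == (j < n)%N)) ==> (s i < s j)%N]].

Section Standardization.
Variables (n : nat) (w : 'I_n -> nat).

Definition std_lt (i j : 'I_n) : bool :=
  (w i < w j)%N || (w i == w j) && (i < j)%N.

Fact std_rank_subproof (i : 'I_n) : (#|[set j | std_lt j i]| < n)%N.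
Proof.
rewrite -[X in (_ < X)%N]card_ord; apply/proper_card/properP; split.
  exact/subsetP.
by exists i => //; rewrite inE /std_lt !ltnn andbF.
Qed.
Definition std_rank (i : 'I_n) : 'I_n := Ordinal (std_rank_subproof i).

Fact std_rank_inj : injective std_rank.
Proof.
have lt i j : std_lt i j -> (std_rank i < std_rank j)%N.
  move=> ij; apply/proper_card/properP; split; last first.
    by exists i; rewrite !inE // /std_lt !ltnn andbF.
  apply/subsetP => k; rewrite !inE /std_lt in ij *.
  move: ij => /orP[ij|/andP[/eqP ij ij']] /orP[ki|/andP[/eqP ki ki']].
  - by rewrite (ltn_trans ki ij).
  - by rewrite ki ij.
  - by rewrite -ij ki.
  - by rewrite ki ij eqxx (ltn_trans ki' ij') orbT.
move=> i j e; have [//|ne] := eqVneq i j.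
have : std_lt i j || std_lt j i.
  rewrite /std_lt; have := ne; rewrite -val_eqE /=.
  by case: (ltngtP (w i) (w j)) => //= _; case: ltngtP.
by case/orP => /lt; rewrite e ltnn.
Qed.

(* [w] is a word of length [n]; positions and letters are numbered from 0. *)
Definition std : 'S_n := perm std_rank_inj.
End Standardization.

Section Cut.
Variables (n : nat) (k : 'I_n.+1).

Fact cut_subproof : (k + (n - k) = n)%N.
Proof. by rewrite subnKC // -ltnS. Qed.
Definition cut_l (i : 'I_k) : 'I_n := cast_ord cut_subproof (lshift (n - k) i).
Definition cut_r (i : 'I_(n - k)) : 'I_n := cast_ord cut_subproof (rshift k i).
End Cut.

End Permutations.

Section TensorOperations.
Variables (K : comPzRingType) (V : lmodType K).

(* [s . (a_1 @ ... @ a_n) = a_(s^-1 1) @ ... @ a_(s^-1 n)] *)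
Definition tact n (s : 'S_n) : tens V n -> tens V n :=
  tlift (fun a => tpure [ffun i => a ((s^-1)%g i)]).

Definition ffcat n m (a : {ffun 'I_n -> V}) (b : {ffun 'I_m -> V}) :
    {ffun 'I_(n + m) -> V} :=
  [ffun i => match split i with inl j => a j | inr j => b j end].

Definition tcat n m (x : tens V n) (y : tens V m) : tens V (n + m) :=
  tlift (fun a => tlift (fun b => tpure (ffcat a b)) y) x.

Definition symmetric_tensor n (t : tens V n) : Prop :=
  forall s : 'S_n, tact s t = t.

Definition tpair (x y : V) : tens V 2 :=
  tpure [ffun i : 'I_2 => if i == ord0 then x else y].

End TensorOperations.

Section ExternalStructure.
Variables (K : comPzRingType) (A : lmodType K).

(* [A^(@ n) @ K S_n], represented by the functions from [S_n] to [A^(@ n)];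
   [hash t s] is [t # s]. *)
Definition Fn (n : nat) : lmodType K := {ffun 'S_n -> tens A n}.

Definition hash n (t : tens A n) (s : 'S_n) : Fn n :=
  [ffun u : 'S_n => if u == s then t else 0].

Definition Fcoef n (f : Fn n) (s : 'S_n) : tens A n :=
  (f : {ffun 'S_n -> tens A n}) s.

Definition FA : lmodType K := dsum Fn.

Definition inF n (f : Fn n) : FA := dsum_in Fn n f.

Definition Fn_act n (p : 'S_n) (f : Fn n) : Fn n :=
  \sum_(s : 'S_n) hash (tact p (Fcoef f s)) (scomp p s).

Definition eprod_n n m (f : Fn n) (g : Fn m) : Fn (n + m) :=
  \sum_(s : 'S_n) \sum_(u : 'S_m) \sum_(p in shuffles n m)
    Fn_act p (hash (tcat (Fcoef f s) (Fcoef g u)) (juxt s u)).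

Definition eprod (y z : FA) : FA :=
  dsum_lift (fun n (f : Fn n) =>
    dsum_lift (fun m (g : Fn m) => inF (eprod_n f g)) z) y.

Definition eone : FA := inF (hash (tpure [ffun=> 0]) (1%g : 'S_0)).

Definition coprod_pure n (s : 'S_n) (a : {ffun 'I_n -> A}) : tens FA 2 :=
  \sum_(k < n.+1)
    tpair (inF (hash (tpure [ffun i => a (cut_l i)])
                     ((std (fun i : 'I_k => (s^-1)%g (cut_l i)))^-1)%g))
          (inF (hash (tpure [ffun i => a (cut_r i)])
                     ((std (fun i : 'I_(n - k) => (s^-1)%g (cut_r i)))^-1)%g)).

Definition coprod_n n (f : Fn n) : tens FA 2 :=
  \sum_(s : 'S_n) tlift (coprod_pure s) (Fcoef f s).

Definition coprod : FA -> tens FA 2 := dsum_lift coprod_n.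

(* [coprod @ id @ ... @ id], with [l] factors [id] *)
Definition coprod_first l : tens FA l.+1 -> tens FA l.+2 :=
  tlift (fun u : {ffun 'I_l.+1 -> FA} =>
    tcat (coprod (u ord0)) (tpure [ffun i : 'I_l => u (lift ord0 i)])
      : tens FA l.+2).

(* With values in the [l.+1]-fold tensor power: [iter_coprod 0] is the identity
   and [iter_coprod 1] is the coproduct. *)
Fixpoint iter_coprod l : FA -> tens FA l.+1 :=
  match l with
  | 0 => fun y => tpure [ffun=> y]
  | l'.+1 => fun y => coprod_first (iter_coprod l' y)
  end.

(* The subalgebra, for the external product [eprod] with unit [eone], generated
   by the [t # e_n] with [t] symmetric. *)
Inductive NT : FA -> Prop :=
| NT_gen n (t : tens A n) : symmetric_tensor t -> NT (inF (hash t 1%g))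
| NT_one : NT eone
| NT_linear (c : K) y z : NT y -> NT z -> NT (c *: y + z)
| NT_mul y z : NT y -> NT z -> NT (eprod y z).

End ExternalStructure.

Section InternalProduct.
Variables (K : comPzRingType) (A : algType K).

(* The product of the algebra [A^(@ n)]: since
   [(a_i b_(s^-1 i))_i = a * (s . b)], it gives the internal product below. *)
Definition tmul n (x y : tens A n) : tens A n :=
  tlift (fun a => tlift (fun b => tpure [ffun i => a i * b i]) y) x.

Definition iprod_n n (f g : Fn A n) : Fn A n :=
  \sum_(s : 'S_n) \sum_(u : 'S_n)
    hash (tmul (Fcoef f s) (tact s (Fcoef g u))) (scomp s u).

Definition iprod (y z : FA A) : FA A :=
  dsum_lift (fun n (f : Fn A n) => inF (iprod_n f (z n))) y.

End InternalProduct.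

Section Linearity.
Variables (K : comPzRingType).

Lemma linear_of_0 (M W : lmodType K) (f : M -> W) : linear f -> f 0 = 0.
Proof. by move=> /(_ (-1) 0 0); rewrite scaler0 addr0 scaleN1r addNr. Qed.

Lemma linear_comp (M N W : lmodType K) (f : N -> W) (g : M -> N) :
  linear f -> linear g -> linear (fun x => f (g x)).
Proof. by move=> lf lg c x y; rewrite lg lf. Qed.

Lemma linear_bigsum (M W : lmodType K) (I : Type) (r : seq I) (P : pred I)
    (F : I -> M -> W) :
  (forall i, linear (F i)) -> linear (fun x => \sum_(i <- r | P i) F i x).
Proof.
move=> lF c x y; rewrite scaler_sumr -big_split.
by apply: eq_bigr => i _; exact: lF.
Qed.

Lemma dsum_lift_fun_linear (I : choiceType) (V : I -> lmodType K)
    (M W : lmodType K) (g : M -> forall i, V i -> W) (f : dsum V) :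
  (forall m i, g m i 0 = 0) -> (forall i v, linear (fun m => g m i v)) ->
  linear (fun m => dsum_lift (g m) f).
Proof.
move=> g0 lg c x y; have [s hs] := dsum_finite f.
rewrite !(dsum_lift_seq (s := s)) // scaler_sumr -big_split.
by apply: eq_bigr => i _; exact: lg.
Qed.

Lemma dsum_in_linear (I : choiceType) (V : I -> lmodType K) (i : I) :
  linear (dsum_in V i).
Proof.
move=> c x y; apply: dsumP => j /=.
by case: (eqVneq i j) => [<-|ij]; rewrite ?dfwith_in ?dfwith_out // scaler0 addr0.
Qed.

Lemma tlift_fun_linear (V M W : lmodType K) n (g : M -> {ffun 'I_n -> V} -> W) t :
  (forall a, linear (fun m => g m a)) -> linear (fun m => tlift (g m) t).
Proof.
move=> lg; apply: dsum_lift_fun_linear => [m a|a k]; first exact: scale0r.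
by move=> c x y; rewrite lg scalerDr !scalerA mulrC.
Qed.

Variable V : lmodType K.

Lemma ffset_perm n (s : 'S_n) (a : {ffun 'I_n -> V}) i v :
  [ffun j => ffset a i v ((s^-1)%g j)]
  = ffset [ffun j => a ((s^-1)%g j)] (s i) v.
Proof.
by apply/ffunP => j; rewrite !ffunE -{1}(permK s i) (inj_eq perm_inj).
Qed.

Fact tact_multilinear n (s : 'S_n) :
  multilinear (fun a : {ffun 'I_n -> V} => tpure [ffun i => a ((s^-1)%g i)]).
Proof. move=> a i c u v; rewrite !ffset_perm; exact: tpure_multilinear. Qed.

Lemma tact_pure n (s : 'S_n) (a : {ffun 'I_n -> V}) :
  tact s (tpure a) = tpure [ffun i => a ((s^-1)%g i)].
Proof. exact/tlift_pure/tact_multilinear. Qed.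

Lemma tact_linear n (s : 'S_n) : linear (@tact K V n s).
Proof. exact/tlift_linear/tact_multilinear. Qed.

Lemma ffcat_setl n m (a : {ffun 'I_n -> V}) (b : {ffun 'I_m -> V}) i v :
  ffcat (ffset a i v) b = ffset (ffcat a b) (lshift m i) v.
Proof.
apply/ffunP => j; rewrite !ffunE; case: (split_ordP j) => k ->; rewrite ?ffunE.
  by rewrite (inj_eq (@lshift_inj _ _)).
by rewrite eq_rlshift.
Qed.

Lemma ffcat_setr n m (a : {ffun 'I_n -> V}) (b : {ffun 'I_m -> V}) i v :
  ffcat a (ffset b i v) = ffset (ffcat a b) (rshift n i) v.
Proof.
apply/ffunP => j; rewrite !ffunE; case: (split_ordP j) => k ->; rewrite ?ffunE.
  by rewrite eq_lrshift.
by rewrite (inj_eq (@rshift_inj _ _)).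
Qed.

Fact tcat_multilinear_r n m (a : {ffun 'I_n -> V}) :
  multilinear (fun b : {ffun 'I_m -> V} => tpure (ffcat a b)).
Proof. move=> b i c u v; rewrite !ffcat_setr; exact: tpure_multilinear. Qed.

Fact tcat_multilinear_l n m (y : tens V m) :
  multilinear (fun a : {ffun 'I_n -> V} => tlift (fun b => tpure (ffcat a b)) y).
Proof.
move=> a i; apply: tlift_fun_linear => b c u v; rewrite !ffcat_setl.
exact: tpure_multilinear.
Qed.

Lemma tcat_pure n m (a : {ffun 'I_n -> V}) (b : {ffun 'I_m -> V}) :
  tcat (tpure a) (tpure b) = tpure (ffcat a b).
Proof.
rewrite /tcat tlift_pure ?tlift_pure //; first exact: tcat_multilinear_r.
exact: tcat_multilinear_l.
Qed.

Lemma tcat_linear_l n m (y : tens V m) : linear (fun x : tens V n => tcat x y).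
Proof. exact/tlift_linear/tcat_multilinear_l. Qed.

Lemma tcat_linear_r n m (x : tens V n) : linear (fun y : tens V m => tcat x y).
Proof.
apply: tlift_fun_linear => a; apply: tlift_linear; exact: tcat_multilinear_r.
Qed.

Lemma tpair_linear_l (y : V) : linear (fun x => tpair x y).
Proof.
have E x : tpair x y = tpure (ffset [ffun=> y] ord0 x).
  by congr tpure; apply/ffunP => i; rewrite !ffunE.
move=> c u v; rewrite !E; exact: tpure_multilinear.
Qed.

Lemma tpair_linear_r (x : V) : linear (fun y => tpair x y).
Proof.
have E y : tpair x y = tpure (ffset [ffun=> x] ord_max y).
  by congr tpure; apply/ffunP => i; rewrite !ffunE; case: i => [[|[]]].
move=> c u v; rewrite !E; exact: tpure_multilinear.
Qed.

End Linearity.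

Section ExternalFormulas.
Variables (K : comPzRingType) (A : lmodType K).

Lemma hash_linear n (s : 'S_n) : linear (fun t : tens A n => hash t s).
Proof.
move=> c x y; apply/ffunP => u; rewrite !ffunE.
by case: ifP; rewrite // scaler0 addr0.
Qed.

Lemma Fcoef_linear n (s : 'S_n) : linear (fun f : Fn A n => Fcoef f s).
Proof. by move=> c f g; rewrite /Fcoef !ffunE. Qed.

Lemma Fcoef_hash n (t : tens A n) s u :
  Fcoef (hash t s) u = if u == s then t else 0.
Proof. by rewrite /Fcoef ffunE. Qed.

Lemma Fn_expand n (f : Fn A n) : f = \sum_(s : 'S_n) hash (Fcoef f s) s.
Proof.
apply/ffunP => u; rewrite sum_ffunE (bigD1 u) //= ffunE eqxx big1 ?addr0 // => s su.
by rewrite ffunE eq_sym (negPf su).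
Qed.

Lemma hash0 n (s : 'S_n) : hash (0 : tens A n) s = 0.
Proof. exact: linear_of_0 (hash_linear s). Qed.

Lemma inF_linear n : linear (@inF K A n).
Proof. exact: dsum_in_linear. Qed.

Lemma inF0 n : inF (0 : Fn A n) = 0.
Proof. exact: linear_of_0 (@inF_linear n). Qed.

Lemma Fn_act_linear n (p : 'S_n) : linear (@Fn_act K A n p).
Proof.
apply: linear_bigsum => s.
apply: (linear_comp (f := fun t => hash (tact p t) (scomp p s))).
  exact: linear_comp (hash_linear _) (tact_linear _).
exact: Fcoef_linear.
Qed.

Lemma Fn_act_hash n (p s : 'S_n) (t : tens A n) :
  Fn_act p (hash t s) = hash (tact p t) (scomp p s).
Proof.
rewrite /Fn_act (bigD1 s) //= Fcoef_hash eqxx big1 ?addr0 // => u us.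
by rewrite Fcoef_hash (negPf us) (linear_of_0 (tact_linear _)) hash0.
Qed.

Lemma eprod_n_linear_l n m (g : Fn A m) : linear (fun f : Fn A n => eprod_n f g).
Proof.
apply: linear_bigsum => s; apply: linear_bigsum => u; apply: linear_bigsum => p.
apply: linear_comp (Fn_act_linear p) _.
apply: (linear_comp (f := fun t => hash (tcat t (Fcoef g u)) (juxt s u))).
  exact: linear_comp (hash_linear _) (tcat_linear_l _).
exact: Fcoef_linear.
Qed.

Lemma eprod_n_linear_r n m (f : Fn A n) : linear (fun g : Fn A m => eprod_n f g).
Proof.
apply: linear_bigsum => s; apply: linear_bigsum => u; apply: linear_bigsum => p.
apply: linear_comp (Fn_act_linear p) _.
apply: (linear_comp (f := fun t => hash (tcat (Fcoef f s) t) (juxt s u))).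
  exact: linear_comp (hash_linear _) (tcat_linear_r _).
exact: Fcoef_linear.
Qed.

Lemma eprod_n_hash n m (x : tens A n) (y : tens A m) s u :
  eprod_n (hash x s) (hash y u)
  = \sum_(p in shuffles n m) hash (tact p (tcat x y)) (scomp p (juxt s u)).
Proof.
rewrite /eprod_n (bigD1 s) //= [X in _ + X]big1 ?addr0; last first.
  move=> s' ss; rewrite big1 // => u' _; rewrite big1 // => p _.
  rewrite Fn_act_hash !Fcoef_hash (negPf ss).
  by rewrite (linear_of_0 (tcat_linear_l _)) (linear_of_0 (tact_linear _)) hash0.
rewrite (bigD1 u) //= [X in _ + X]big1 ?addr0; last first.
  move=> u' uu; rewrite big1 // => p _; rewrite Fn_act_hash !Fcoef_hash (negPf uu).
  by rewrite (linear_of_0 (tcat_linear_r _)) (linear_of_0 (tact_linear _)) hash0.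
by apply: eq_bigr => p _; rewrite Fn_act_hash !Fcoef_hash !eqxx.
Qed.

Lemma eprod_linear_r (y : FA A) : linear (eprod y).
Proof.
apply: dsum_lift_fun_linear => [z n|n f].
  rewrite /dsum_lift fsbig1 // => m _.
  by rewrite (linear_of_0 (eprod_n_linear_l _)) inF0.
apply: dsum_lift_linear => m.
exact: linear_comp (@inF_linear _) (eprod_n_linear_r _).
Qed.

Lemma eprod_linear_l (z : FA A) : linear (fun y => eprod y z).
Proof.
apply: dsum_lift_linear => n; apply: dsum_lift_fun_linear => [f m|m g].
  by rewrite (linear_of_0 (eprod_n_linear_r _)) inF0.
exact: linear_comp (@inF_linear _) (eprod_n_linear_l _).
Qed.

Lemma eprod_in n m (f : Fn A n) (g : Fn A m) :
  eprod (inF f) (inF g) = inF (eprod_n f g).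
Proof.
rewrite /eprod [inF f]/inF [inF g]/inF dsum_lift_in ?dsum_lift_in // => k.
  by rewrite (linear_of_0 (eprod_n_linear_r _)) inF0.
rewrite /dsum_lift fsbig1 // => j _.
by rewrite (linear_of_0 (eprod_n_linear_l _)) inF0.
Qed.

Fact coprod_pure_multilinear n (s : 'S_n) : multilinear (@coprod_pure K A n s).
Proof.
move=> a i; apply: linear_bigsum => k.
case: (split_ordP (cast_ord (esym (cut_subproof k)) i)) => j ej.
- have ei : i = cut_l j by rewrite /cut_l -ej cast_ordKV.
  have El v : [ffun h => ffset a i v (cut_l h)]
      = ffset [ffun h => a (cut_l h)] j v :> {ffun 'I_k -> A}.
    apply/ffunP => h; rewrite !ffunE ei /cut_l (inj_eq (@cast_ord_inj _ _ _)).
    by rewrite (inj_eq (@lshift_inj _ _)).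
  have Er v : [ffun h => ffset a i v (cut_r h)] = [ffun h => a (cut_r h)]
      :> {ffun 'I_(n - k) -> A}.
    apply/ffunP => h; rewrite !ffunE ei /cut_l /cut_r (inj_eq (@cast_ord_inj _ _ _)).
    by rewrite eq_rlshift.
  move=> c u v; rewrite !El !Er tpure_multilinear hash_linear.
  by rewrite inF_linear tpair_linear_l.
- have ei : i = cut_r j by rewrite /cut_r -ej cast_ordKV.
  have El v : [ffun h => ffset a i v (cut_r h)]
      = ffset [ffun h => a (cut_r h)] j v :> {ffun 'I_(n - k) -> A}.
    apply/ffunP => h; rewrite !ffunE ei /cut_r (inj_eq (@cast_ord_inj _ _ _)).
    by rewrite (inj_eq (@rshift_inj _ _)).
  have Er v : [ffun h => ffset a i v (cut_l h)] = [ffun h => a (cut_l h)]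
      :> {ffun 'I_k -> A}.
    apply/ffunP => h; rewrite !ffunE ei /cut_l /cut_r (inj_eq (@cast_ord_inj _ _ _)).
    by rewrite eq_lrshift.
  move=> c u v; rewrite !El !Er tpure_multilinear hash_linear.
  by rewrite inF_linear tpair_linear_r.
Qed.

Lemma coprod_n_linear n : linear (@coprod_n K A n).
Proof.
apply: linear_bigsum => s.
exact: linear_comp (tlift_linear (coprod_pure_multilinear s)) (Fcoef_linear s).
Qed.

Lemma coprod_linear : linear (@coprod K A).
Proof. by apply: dsum_lift_linear => n; exact: coprod_n_linear. Qed.

Lemma coprod_hash n (a : {ffun 'I_n -> A}) (s : 'S_n) :
  coprod (inF (hash (tpure a) s)) = coprod_pure s a.
Proof.
rewrite /coprod /inF dsum_lift_in => [|m]; last exact: linear_of_0 (@coprod_n_linear m).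
rewrite /coprod_n (bigD1 s) //= Fcoef_hash eqxx big1 ?addr0.
  exact: tlift_pure (coprod_pure_multilinear s).
move=> u us; rewrite Fcoef_hash (negPf us).
exact: linear_of_0 (tlift_linear (coprod_pure_multilinear u)).
Qed.

Fact coprod_first_multilinear l :
  multilinear (fun u : {ffun 'I_l.+1 -> FA A} =>
    tcat (coprod (u ord0)) (tpure [ffun i : 'I_l => u (lift ord0 i)])
      : tens (FA A) l.+2).
Proof.
move=> u i; case: (unliftP ord0 i) => [j ->|->] c x y.
  have E v : [ffun k => ffset u (lift ord0 j) v (lift ord0 k)]
      = ffset [ffun k => u (lift ord0 k)] j v.
    by apply/ffunP => k; rewrite !ffunE (inj_eq (@lift_inj _ _)).
  have E0 v : ffset u (lift ord0 j) v ord0 = u ord0 by rewrite ffunE.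
  by rewrite !E !E0 tpure_multilinear tcat_linear_r.
have E v : [ffun k => ffset u ord0 v (lift ord0 k)] = [ffun k => u (lift ord0 k)].
  by apply/ffunP => k; rewrite !ffunE.
have E0 v : ffset u ord0 v ord0 = v by rewrite ffunE eqxx.
by rewrite !E !E0 coprod_linear tcat_linear_l.
Qed.

Lemma coprod_first_pure l (u : {ffun 'I_l.+1 -> FA A}) :
  coprod_first (tpure u)
  = tcat (coprod (u ord0)) (tpure [ffun i : 'I_l => u (lift ord0 i)]).
Proof. exact/tlift_pure/coprod_first_multilinear. Qed.

Lemma coprod_first_linear l : linear (@coprod_first K A l).
Proof. exact/tlift_linear/coprod_first_multilinear. Qed.

End ExternalFormulas.

Section InternalFormulas.
Variables (K : comPzRingType) (A : algType K).

Fact tmul_multilinear_r n (a : {ffun 'I_n -> A}) :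
  multilinear (fun b : {ffun 'I_n -> A} => tpure [ffun i => a i * b i]).
Proof.
have E b i v : [ffun j => a j * ffset b i v j]
    = ffset [ffun j => a j * b j] i (a i * v).
  by apply/ffunP => j; rewrite !ffunE; case: eqP => // ->.
by move=> b i c u v; rewrite !E mulrDr -scalerAr tpure_multilinear.
Qed.

Fact tmul_multilinear_l n (y : tens A n) :
  multilinear (fun a : {ffun 'I_n -> A} =>
    tlift (fun b => tpure [ffun i => a i * b i]) y).
Proof.
have E (a b : {ffun 'I_n -> A}) i v : [ffun j => ffset a i v j * b j]
    = ffset [ffun j => a j * b j] i (v * b i).
  by apply/ffunP => j; rewrite !ffunE; case: eqP => // ->.
move=> a i; apply: tlift_fun_linear => b c u v.
by rewrite !E mulrDl -scalerAl tpure_multilinear.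
Qed.

Lemma tmul_linear_l n (y : tens A n) : linear (fun x => tmul x y).
Proof. exact/tlift_linear/tmul_multilinear_l. Qed.

Lemma tmul_linear_r n (x : tens A n) : linear (tmul x).
Proof. by apply: tlift_fun_linear => a; exact/tlift_linear/tmul_multilinear_r. Qed.

Lemma tmul_pure n (a b : {ffun 'I_n -> A}) :
  tmul (tpure a) (tpure b) = tpure [ffun i => a i * b i].
Proof.
rewrite /tmul tlift_pure ?tlift_pure //; first exact: tmul_multilinear_r.
exact: tmul_multilinear_l.
Qed.

Lemma iprod_n_linear_l n (g : Fn A n) : linear (fun f : Fn A n => iprod_n f g).
Proof.
apply: linear_bigsum => s; apply: linear_bigsum => u.
apply: (linear_comp (f := fun t => hash (tmul t (tact s (Fcoef g u))) (scomp s u))).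
  exact: linear_comp (hash_linear _) (tmul_linear_l _).
exact: Fcoef_linear.
Qed.

Lemma iprod_n_linear_r n (f : Fn A n) : linear (iprod_n f).
Proof.
apply: linear_bigsum => s; apply: linear_bigsum => u.
apply: (linear_comp (f := fun t => hash (tmul (Fcoef f s) (tact s t)) (scomp s u))).
  apply: linear_comp (hash_linear _) _.
  exact: linear_comp (tmul_linear_r _) (tact_linear _).
exact: Fcoef_linear.
Qed.

Lemma iprod_n_hash n (a b : {ffun 'I_n -> A}) (s u : 'S_n) :
  iprod_n (hash (tpure a) s) (hash (tpure b) u)
  = hash (tpure [ffun i => a i * b ((s^-1)%g i)]) (scomp s u).
Proof.
rewrite /iprod_n (bigD1 s) //= [X in _ + X]big1 ?addr0; last first.
  move=> s' ss; rewrite big1 // => u' _; rewrite Fcoef_hash (negPf ss).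
  by rewrite (linear_of_0 (tmul_linear_l _)) hash0.
rewrite (bigD1 u) //= [X in _ + X]big1 ?addr0; last first.
  move=> u' uu; rewrite !Fcoef_hash (negPf uu) (linear_of_0 (tact_linear _)).
  by rewrite (linear_of_0 (tmul_linear_r _)) hash0.
rewrite !Fcoef_hash !eqxx tact_pure tmul_pure.
by congr (hash (tpure _) _); apply/ffunP => i; rewrite !ffunE.
Qed.

Lemma iprod_linear_l (z : FA A) : linear (fun y => iprod y z).
Proof.
apply: dsum_lift_linear => n.
exact: linear_comp (@inF_linear _ _ _) (iprod_n_linear_l _).
Qed.

Lemma iprodE (y z : FA A) n : iprod y z n = iprod_n (y n) (z n).
Proof.
have z0 m : inF (iprod_n 0 (z m)) = 0.
  by rewrite (linear_of_0 (iprod_n_linear_l _)) inF0.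
have [s hs] := dsum_finite y; rewrite /iprod (dsum_lift_seq (s := s)) //.
have E : {morph (fun f : FA A => f n) : x y / x + y} by [].
rewrite (big_morph _ E (erefl : (0 : FA A) n = 0)).
case: (boolP (n \in s)) => sn; last first.
  rewrite hs // (linear_of_0 (iprod_n_linear_l _)) big1_seq // => j.
  rewrite mem_undup => /= sj; rewrite dfwith_out //.
  by apply: contraNneq sn => <-.
rewrite (bigD1_seq n) ?mem_undup ?undup_uniq //= dfwith_in big1 ?addr0 // => j ji.
by rewrite dfwith_out.
Qed.

Lemma iprod_linear_r (y : FA A) : linear (iprod y).
Proof.
move=> c u v; apply: dsumP => n.
by rewrite iprodE /= iprod_n_linear_r !iprodE.
Qed.

Fact sweedler_multilinear l (z : 'I_l -> FA A) :
  multilinear (fun u : {ffun 'I_l -> FA A} =>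
    \big[@eprod K A/eone A]_(i < l) iprod (u i) (z i)).
Proof.
elim: l z => [|l IH] z u i; first by case: i.
have E w : \big[@eprod K A/eone A]_(i < l.+1) iprod (w i) (z i)
  = eprod (iprod (w ord0) (z ord0))
     (\big[@eprod K A/eone A]_(i < l) iprod ([ffun i => w (lift ord0 i)] i) (z (lift ord0 i))).
  by rewrite big_ord_recl; congr eprod; apply: eq_bigr => j _; rewrite ffunE.
case: (unliftP ord0 i) => [j ->|->] c x y; rewrite !E.
  have E1 v : [ffun k => ffset u (lift ord0 j) v (lift ord0 k)]
      = ffset [ffun k => u (lift ord0 k)] j v.
    by apply/ffunP => k; rewrite !ffunE (inj_eq (@lift_inj _ _)).
  have E0 v : ffset u (lift ord0 j) v ord0 = u ord0 by rewrite ffunE.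
  by rewrite !E1 !E0 (IH (fun i => z (lift ord0 i))) eprod_linear_r.
have E1 v : [ffun k => ffset u ord0 v (lift ord0 k)] = [ffun k => u (lift ord0 k)].
  by apply/ffunP => k; rewrite !ffunE.
have E0 v : ffset u ord0 v ord0 = v by rewrite ffunE eqxx.
by rewrite !E1 !E0 iprod_linear_l eprod_linear_l.
Qed.

End InternalFormulas.

(* Main.v *)
(* An element a_1 @ ... @ a_n # s is written as a word: its letters carry the
   tensor factors a_i and the values of a word w whose standardization is s^-1.
   Then the coproduct cuts words into a prefix and a suffix, and the external
   product sums over the shuffles, a transversal of S_n x S_m in S_(n + m).
   An element of NT is a combination of sums of words over families that are
   invariant under permutation of the letters. It therefore suffices to compare
   the two sides, as functions of one word, modulo the differences
   E (word permuted by g) - E (word) with E multilinear in the tensor factors.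
   For two factors, both sides are sums over shuffles whose terms match up to
   such permutations (uniqueness of the shuffle in a coset); the general case
   follows by cutting off the first factor. *)

Require Import Defs.
From mathcomp Require Import all_boot all_algebra.
From mathcomp Require Import boolp fingroup perm zify.

Set Implicit Arguments.
Unset Strict Implicit.
Unset Printing Implicit Defensive.

Import GRing.Theory.
Local Open Scope ring_scope.

(** * Standardization and shuffles *)

(** The rank of [i] counts the positions before it, and [g] carries these bijectively onto the
    values below [g i]. *)
Lemma std_unique n (w : 'I_n -> nat) (g : 'S_n) :
  (forall i j, std_lt w i j = (g i < g j)%N) -> std w = g.
Proof.
move=> wg; apply/permP => i; rewrite permE; apply: val_inj => /=.
have -> : [set j | std_lt w j i] = g @^-1: [set k : 'I_n | (k < g i)%N].
  by apply/setP => j; rewrite !inE wg.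
rewrite card_preimset; last exact: perm_inj.
by rewrite -sum1dep_card -(big_ord_widen _ (fun=> 1%N) (ltnW (ltn_ord _)))
  sum1_card card_ord.
Qed.

Lemma std_ltE n (w : 'I_n -> nat) i j : std_lt w i j = (std w i < std w j)%N.
Proof.
have lt h k : std_lt w h k -> (std w h < std w k)%N.
  rewrite !permE /= => hk; apply/proper_card/properP; split; last first.
    by exists h; rewrite !inE // /std_lt !ltnn andbF.
  apply/subsetP => l; rewrite !inE /std_lt in hk *.
  by lia.
apply/idP/idP; first exact: lt.
apply: contraTT => nij; rewrite -leqNgt.
have [->//|ne] := eqVneq i j.
apply/ltnW/lt; move: nij ne; rewrite -val_eqE /std_lt /=; lia.
Qed.

Lemma std_eq n (w w' : 'I_n -> nat) :
  (forall i j, std_lt w i j = std_lt w' i j) -> std w = std w'.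
Proof. by move=> ww; apply: std_unique => i j; rewrite ww std_ltE. Qed.

Lemma std_perm n (g : 'S_n) : std (fun i => g i) = g.
Proof.
apply: std_unique => i j; rewrite /std_lt val_eqE (inj_eq perm_inj).
by case: eqVneq => [->|]; rewrite ?ltnn // orbF.
Qed.

Lemma std_id n : std (fun i : 'I_n => i) = 1%g.
Proof. by rewrite -[RHS]std_perm; apply: std_eq => i j; rewrite /std_lt !perm1. Qed.

(** An increasing [f] keeps both the order of the letters and the breaking of ties by position, so
    relative order within a subword is already visible in [std w]. *)
Lemma std_sub n k (w : 'I_n -> nat) (f : 'I_k -> 'I_n) :
  (forall i j, (f i < f j)%N = (i < j)%N) ->
  std (fun i => std w (f i)) = std (fun i => w (f i)).
Proof.
move=> fE; apply: std_eq => i j; transitivity (std_lt w (f i) (f j)).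
  rewrite [RHS]std_ltE /std_lt val_eqE (inj_eq perm_inj) -fE.
  by case: eqVneq => [->|_]; rewrite ?ltnn // orbF.
by rewrite /std_lt fE.
Qed.

Lemma juxt_lshift n m (s : 'S_n) (u : 'S_m) i :
  juxt s u (lshift m i) = lshift m (s i).
Proof. by rewrite permE /juxt_fun (unsplitK (inl i)). Qed.

Lemma juxt_rshift n m (s : 'S_n) (u : 'S_m) i :
  juxt s u (rshift n i) = rshift n (u i).
Proof. by rewrite permE /juxt_fun (unsplitK (inr i)). Qed.

Lemma juxtM n m (s s' : 'S_n) (u u' : 'S_m) :
  (juxt s u * juxt s' u')%g = juxt (s * s')%g (u * u')%g.
Proof.
apply/permP => i; rewrite permM.
by case: (split_ordP i) => j ->; rewrite ?juxt_lshift ?juxt_rshift permM.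
Qed.

Lemma juxt1 n m : juxt 1%g 1%g = 1%g :> 'S_(n + m).
Proof.
apply/permP => i; rewrite perm1.
by case: (split_ordP i) => j ->; rewrite ?juxt_lshift ?juxt_rshift perm1.
Qed.

Lemma juxtV n m (s : 'S_n) (u : 'S_m) : (juxt s u)^-1%g = juxt s^-1%g u^-1%g.
Proof. by apply: (mulgI (juxt s u)); rewrite mulgV juxtM !mulgV juxt1. Qed.

Section Transversal.
Variables n m : nat.
Implicit Types (x g : 'S_(n + m)) (s : 'S_n) (u : 'S_m).

Lemma shuffles_lshift x i j : x \in shuffles n m ->
  (x (lshift m i) < x (lshift m j))%N = (i < j)%N.
Proof.
rewrite inE => /forallP xS.
have lt (h k : 'I_n) : (h < k)%N -> (x (lshift m h) < x (lshift m k))%N.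
  move=> hk; have /forallP/(_ (lshift m k))/implyP := xS (lshift m h).
  by apply; rewrite hk /= !ltn_ord.
apply/idP/idP; last exact: lt.
apply: contraTT; rewrite -!leqNgt leq_eqVlt => /orP[/eqP e|/lt/ltnW//].
by rewrite (val_inj e).
Qed.

Lemma shuffles_rshift x i j : x \in shuffles n m ->
  (x (rshift n i) < x (rshift n j))%N = (i < j)%N.
Proof.
rewrite inE => /forallP xS.
have lt (h k : 'I_m) : (h < k)%N -> (x (rshift n h) < x (rshift n k))%N.
  move=> hk; have /forallP/(_ (rshift n k))/implyP := xS (rshift n h).
  by apply; rewrite /= ltn_add2l hk !ltnNge !leq_addr.
apply/idP/idP; last exact: lt.
apply: contraTT; rewrite -!leqNgt leq_eqVlt => /orP[/eqP e|/lt/ltnW//].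
by rewrite (val_inj e).
Qed.

Lemma shufflesP x :
  (forall i j : 'I_n, (i < j)%N -> (x (lshift m i) < x (lshift m j))%N) ->
  (forall i j : 'I_m, (i < j)%N -> (x (rshift n i) < x (rshift n j))%N) ->
  x \in shuffles n m.
Proof.
move=> xl xr; rewrite inE; apply/forallP => i; apply/forallP => j.
apply/implyP => /andP[]; case: (split_ordP i) => i' ->; case: (split_ordP j) => j' -> /=.
- by move=> /xl.
- by have := ltn_ord i'; lia.
- by have := ltn_ord j'; lia.
- by rewrite ltn_add2l => /xr.
Qed.

Definition block_std (w : 'I_(n + m) -> nat) : 'S_(n + m) :=
  juxt (std (fun i => w (lshift m i))) (std (fun i => w (rshift n i))).

(* The shuffle in the coset of [g]; permutations compose left to right here, so
   [juxt s u * g] rearranges the values of [g] inside the two blocks. *)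
Definition shuffle_rep g : 'S_(n + m) := ((block_std (fun i => g i))^-1 * g)%g.

Lemma shuffle_rep_in g : shuffle_rep g \in shuffles n m.
Proof.
rewrite /shuffle_rep /block_std juxtV.
have H k (f : 'I_k -> 'I_(n + m)) : injective f ->
    forall i j : 'I_k, (i < j)%N ->
    (g (f ((std (fun i => g (f i)))^-1%g i)) < g (f ((std (fun i => g (f i)))^-1%g j)))%N.
  move=> fI i j; rewrite -{1}(permKV (std (fun i => g (f i))) i).
  rewrite -{1}(permKV (std (fun i => g (f i))) j) -std_ltE /std_lt.
  case/orP=> // /andP[/eqP/val_inj/perm_inj/fI ->]; by rewrite ltnn.
apply: shufflesP => i j ij; rewrite !permM ?juxt_lshift ?juxt_rshift.
  exact: H (@lshift_inj _ _) _ _ ij.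
exact: H (@rshift_inj _ _) _ _ ij.
Qed.

(** Uniqueness of the shuffle in a coset: both are increasing on the two blocks, which forces [s]
    and [u] to be increasing, hence trivial. *)
Lemma shuffles_juxt x x' s u :
  x \in shuffles n m -> x' \in shuffles n m -> x' = (juxt s u * x)%g -> x' = x.
Proof.
move=> xS xS' e.
have s1 : s = 1%g.
  rewrite -(std_perm s) -std_id; apply: std_eq => i j; rewrite !std_ltE std_perm std_id !perm1.
  by rewrite -(shuffles_lshift i j xS') e !permM !juxt_lshift shuffles_lshift.
have u1 : u = 1%g.
  rewrite -(std_perm u) -std_id; apply: std_eq => i j; rewrite !std_ltE std_perm std_id !perm1.
  by rewrite -(shuffles_rshift i j xS') e !permM !juxt_rshift shuffles_rshift.
by rewrite e s1 u1 juxt1 mul1g.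
Qed.

(** Translation by [g] permutes the cosets of S_n x S_m, so it induces a bijection of the shuffles
    representing them. *)
Lemma sum_shuffle_rep (V : nmodType) (F : 'S_(n + m) -> V) g :
  \sum_(x in shuffles n m) F (shuffle_rep (x * g)%g) = \sum_(x in shuffles n m) F x.
Proof.
pose h x := shuffle_rep (x * g)%g.
have hI : {in shuffles n m &, injective h}.
  (* Cancelling the block part of [x' * g] and [g] itself leaves [x'] equal to [x] times an element
     of S_n x S_m. *)
  move=> x x' xS xS' /(congr1 (fun y => block_std (fun i => (x' * g)%g i) * y * g^-1)%g).
  rewrite /h /shuffle_rep mulgA mulKVg mulgK /block_std juxtV !mulgA mulgK juxtM => e.
  exact: esym (shuffles_juxt xS xS' (esym e)).
have hE : h @: shuffles n m = shuffles n m.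
  apply/eqP; rewrite eqEcard card_in_imset // leqnn andbT.
  apply/subsetP => _ /imsetP[x _ ->]; exact: shuffle_rep_in.
by rewrite -[in RHS]hE big_imset.
Qed.
End Transversal.

(** * Consequences of linearity *)

Section LinearMap.
Variables (K : comPzRingType) (M W : lmodType K) (f : M -> W).
Hypothesis lf : linear f.

Lemma linear_of_D x y : f (x + y) = f x + f y.
Proof. by rewrite -{1}[x]scale1r lf scale1r. Qed.

Lemma linear_of_Z c x : f (c *: x) = c *: f x.
Proof. by rewrite -[c *: x]addr0 lf (linear_of_0 lf) addr0. Qed.

Lemma linear_of_B x y : f (x - y) = f x - f y.
Proof. by rewrite linear_of_D -scaleN1r linear_of_Z scaleN1r. Qed.

Lemma linear_of_sum (I : Type) (r : seq I) (P : pred I) (F : I -> M) :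
  f (\sum_(i <- r | P i) F i) = \sum_(i <- r | P i) f (F i).
Proof. exact: (big_morph f linear_of_D (linear_of_0 lf)). Qed.
End LinearMap.

(* Permutations act on sequences indexed by [nat], fixing the indices from [n]
   on, so that the sizes of words never appear in their types. *)
Definition permn n (g : 'S_n) (j : nat) : nat :=
  if insub j is Some i then val (g i) else j.

Lemma permnE n (g : 'S_n) (i : 'I_n) : permn g i = g i.
Proof. by rewrite /permn valK. Qed.

Lemma permn_ge n (g : 'S_n) j : (n <= j)%N -> permn g j = j.
Proof. by move=> nj; rewrite /permn insubF // ltnNge nj. Qed.

Lemma permnM n (g h : 'S_n) j : permn (g * h)%g j = permn h (permn g j).
Proof.
case: (ltnP j n) => jn; last by rewrite !permn_ge.
by rewrite -[j]/(val (Ordinal jn)) !permnE permM.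
Qed.

Lemma permn1 n j : permn (1%g : 'S_n) j = j.
Proof. by rewrite /permn; case: insubP => // i _ <-; rewrite perm1. Qed.

Definition ncat T n (f g : nat -> T) (j : nat) : T :=
  if (j < n)%N then f j else g (j - n)%N.

Lemma permn_lt n (g : 'S_n) j : (j < n)%N -> (permn g j < n)%N.
Proof. by move=> jn; rewrite -[j]/(val (Ordinal jn)) permnE. Qed.

Lemma permn_juxt_lt n m (s : 'S_n) (u : 'S_m) j : (j < n)%N ->
  permn (juxt s u) j = permn s j.
Proof.
move=> jn; pose i := Ordinal jn.
by rewrite (permnE s i) (permnE (juxt s u) (lshift m i)) juxt_lshift.
Qed.

Lemma permn_juxt_addl n m (s : 'S_n) (u : 'S_m) j :
  permn (juxt s u) (n + j) = (n + permn u j)%N.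
Proof.
case: (ltnP j m) => jm; last by rewrite !permn_ge ?leq_add2l.
pose i := Ordinal jm.
by rewrite (permnE u i) (permnE (juxt s u) (rshift n i)) juxt_rshift.
Qed.

Lemma ncat_permn T n m (s : 'S_n) (u : 'S_m) (f g : nat -> T) :
  ncat n (fun j => f (permn s j)) (fun j => g (permn u j))
  = (fun j => ncat n f g (permn (juxt s u) j)).
Proof.
apply: funext => j; rewrite /ncat; case: (ltnP j n) => jn.
  by rewrite permn_juxt_lt // permn_lt.
by rewrite -(subnKC jn) permn_juxt_addl addKn ltnNge leq_addr addKn.
Qed.

Definition upd T (b : nat -> T) (i : nat) (v : T) (j : nat) : T :=
  if j == i then v else b j.

Lemma upd_permn T n (g : 'S_n) (b : nat -> T) (i : nat) v : (i < n)%N ->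
  (fun j => upd b i v (permn g j))
  = upd (fun j => b (permn g j)) (permn g^-1%g i) v.
Proof.
move=> ilt; apply: funext => j; rewrite /upd.
suff -> : (permn g j == i) = (j == permn g^-1%g i) by [].
apply/eqP/eqP => [<-|->]; rewrite -permnM ?mulgV ?mulVg permn1 //.
Qed.

(** * Words *)

Section Words.
Variables (K : comPzRingType) (A : lmodType K).
Implicit Types (b : nat -> A) (w : nat -> nat).

(** The permutation is stored inverted: the coproduct then standardizes pieces of [g] itself, and
    the internal product multiplies permutations in the order of [{perm T}]. *)
Definition pure_hash n b (g : 'S_n) : FA A :=
  inF (hash (tpure [ffun i : 'I_n => b i]) g^-1%g).

Definition stdn n w : 'S_n := std (fun i : 'I_n => w i).

Definition word n b w : FA A := pure_hash b (stdn n w).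

Lemma stdn_eq n w w' : (forall i, (i < n)%N -> w i = w' i) -> stdn n w = stdn n w'.
Proof.
by move=> e; congr (std _); apply: funext => i; rewrite e.
Qed.

Lemma pure_hash_eq n b b' (g : 'S_n) :
  (forall i, (i < n)%N -> b i = b' i) -> pure_hash b g = pure_hash b' g.
Proof.
by move=> e; congr (inF (hash (tpure _) _)); apply/ffunP => i; rewrite !ffunE e.
Qed.

Lemma word_eq n b b' w w' : (forall i, (i < n)%N -> b i = b' i) ->
  (forall i, (i < n)%N -> w i = w' i) -> word n b w = word n b' w'.
Proof. by move=> eb ew; rewrite /word (stdn_eq ew) (pure_hash_eq _ eb). Qed.

Lemma pure_hash_linear n (g : 'S_n) b i : (i < n)%N ->
  linear (fun v => pure_hash (upd b i v) g).
Proof.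
move=> ilt c u v.
have E x : [ffun j : 'I_n => upd b i x j]
    = ffset [ffun j : 'I_n => b j] (Ordinal ilt) x.
  by apply/ffunP => j; rewrite !ffunE -val_eqE.
by rewrite /pure_hash !E tpure_multilinear hash_linear inF_linear.
Qed.

Definition zero_ext n (a : {ffun 'I_n -> A}) (j : nat) : A :=
  if insub j is Some i then a i else 0.

Lemma ffun_zero_ext n (a : {ffun 'I_n -> A}) : [ffun i : 'I_n => zero_ext a i] = a.
Proof. by apply/ffunP => i; rewrite ffunE /zero_ext valK. Qed.

(** Linear induction: the degrees, the basis of permutations and the pure tensors together span
    [FA A]. *)
Lemma FA_ind (P : FA A -> Prop) :
  P 0 -> (forall c y z, P y -> P z -> P (c *: y + z)) ->
  (forall n b (g : 'S_n), P (pure_hash b g)) -> forall y, P y.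
Proof.
move=> P0 PL PH.
have PD y z : P y -> P z -> P (y + z) by move=> *; rewrite -[y]scale1r; exact: PL.
have PS (I : Type) (r : seq I) (F : I -> FA A) :
    (forall i, P (F i)) -> P (\sum_(i <- r) F i).
  by move=> PF; elim/big_ind: _.
move=> y; rewrite (dsum_expand y); have [s hs] := dsum_finite y.
rewrite (dsum_lift_seq (s := s)) => // [|n]; last exact: inF0.
apply: (PS) => n; rewrite -/(inF _) (Fn_expand (y n)).
rewrite (linear_of_sum (@inF_linear _ A n)).
apply: (PS) => g; have [r [c ->]] := tens_span (Fcoef (y n) g).
have L : linear (fun t => inF (hash t g)) :=
  linear_comp (@inF_linear _ A n) (hash_linear g).
rewrite (linear_of_sum L).
apply: (PS) => a; rewrite (linear_of_Z L) -[X in P X]addr0.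
apply: (PL _ _ _ _ P0) => {PL PS PD}.
rewrite -(ffun_zero_ext a) -(invgK g); exact: PH.
Qed.

Lemma eprod_pure_hash n m b b' (g : 'S_n) (g' : 'S_m) :
  eprod (pure_hash b g) (pure_hash b' g')
  = \sum_(x in shuffles n m)
     pure_hash (fun j => ncat n b b' (permn x^-1%g j)) (x^-1 * juxt g g')%g.
Proof.
rewrite /pure_hash eprod_in eprod_n_hash.
rewrite (linear_of_sum (@inF_linear _ A _)).
apply: eq_bigr => x _; congr inF; rewrite tcat_pure tact_pure; congr (hash (tpure _) _).
  apply/ffunP => i; rewrite !ffunE /ncat permnE.
  by case: (split_ordP (x^-1%g i)) => j -> /=; rewrite ffunE ?addKn.
by rewrite /scomp invMg juxtV !invgK.
Qed.

(* The letters of the second word are shifted above those of the first, so that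
   standardizing a shuffle never compares letters of the two words. *)
Lemma eprod_word n m k b b' w w' : (forall i, (i < n)%N -> (w i < k)%N) ->
  eprod (word n b w) (word m b' w')
  = \sum_(x in shuffles n m)
     word (n + m) (fun j => ncat n b b' (permn x^-1%g j))
       (fun j => ncat n w (fun i => k + w' i)%N (permn x^-1%g j)).
Proof.
move=> wk; rewrite eprod_pure_hash; apply: eq_bigr => x xS; congr pure_hash.
apply/esym/std_unique => i j; rewrite !permM /std_lt !permnE.
(* Positions enter only through ties, which occur inside a block; there the shuffle [x] is
   increasing, so ties break as in the separate words. *)
have -> : (i < j)%N = (x (x^-1%g i) < x (x^-1%g j))%N by rewrite !permKV.
move: (x^-1%g i) (x^-1%g j) => {}i {}j; rewrite /ncat.
case: (split_ordP i) => {}i ->; case: (split_ordP j) => {}j -> /=.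
- rewrite !juxt_lshift shuffles_lshift //= -std_ltE /std_lt //.
- rewrite juxt_lshift juxt_rshift /=.
  have := wk i (ltn_ord i); have := ltn_ord (stdn n w i); lia.
- rewrite juxt_lshift juxt_rshift /=.
  have := wk j (ltn_ord j); have := ltn_ord (stdn n w j); lia.
- rewrite !addKn /= !juxt_rshift shuffles_rshift //=.
  by rewrite !ltn_add2l eqn_add2l -std_ltE.
Qed.
(** By [std_sub], standardizing a piece of [std w] amounts to standardizing the same piece of
    [w]. *)
Lemma coprod_word n b w :
  coprod (word n b w)
  = \sum_(k < n.+1) tpair (word k b w)
      (word (n - k) (fun j => b (k + j)%N) (fun j => w (k + j)%N)).
Proof.
rewrite coprod_hash; apply: eq_bigr => k _; congr tpair.
- congr (inF (hash (tpure _) _^-1)%g); first by apply/ffunP => i; rewrite !ffunE.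
  by rewrite invgK std_sub.
- congr (inF (hash (tpure _) _^-1)%g); first by apply/ffunP => i; rewrite !ffunE.
  by rewrite invgK std_sub // => i j; rewrite /= ltn_add2l.
Qed.

Lemma word_coef n b (g : 'S_n) m : m != n -> pure_hash b g m = 0.
Proof. by move=> mn; rewrite /pure_hash /inF /= dfwith_out // eq_sym. Qed.

(** Serves for lengths such as [n + 0] and [n]; comparing the permutations through [permn] avoids
    casts. *)
Lemma pure_hash_cast n n' b b' (g : 'S_n) (g' : 'S_n') : n' = n ->
  (forall i, (i < n)%N -> b' i = b i) ->
  (forall i, (i < n)%N -> permn g' i = permn g i) ->
  pure_hash b' g' = pure_hash b g.
Proof.
move=> e; subst n' => eb eg; suff -> : g' = g by exact: pure_hash_eq.
by apply/permP => i; apply: val_inj; rewrite /= -!permnE eg.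
Qed.

Lemma eprodr1 (y : FA A) : eprod y (eone A) = y.
Proof.
elim/FA_ind: y => [|c y z yE zE|n b g].
- exact: linear_of_0 (eprod_linear_l _).
- by rewrite eprod_linear_l yE zE.
have -> : eone A = pure_hash (fun=> 0) (1%g : 'S_0).
  by rewrite /pure_hash invg1; congr (inF (hash (tpure _) _)); apply/ffunP; case.
rewrite eprod_pure_hash (bigD1 1%g) /=; last first.
  by apply: shufflesP => i j ij; rewrite !perm1 /= ?ltn_add2l.
(* With an empty second block a shuffle is increasing everywhere, so it is the identity. *)
rewrite big1 ?addr0 => [|x /andP[xS /negP[]]]; last first.
  rewrite -(std_perm x) -std_id; apply/eqP/std_eq => i j; rewrite /std_lt.
  case: (split_ordP i) => [{}i -> |[]//]; case: (split_ordP j) => [{}j -> |[]//].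
  by rewrite shuffles_lshift //=; case: (i < j)%N; rewrite ?andbF.
rewrite invg1 mul1g; apply: pure_hash_cast; first by rewrite addn0.
  by move=> i ilt; rewrite permn1 /ncat ilt.
by move=> i ilt; rewrite permn_juxt_lt.
Qed.

End Words.

(** * Splitting off the first tensor factor *)

Lemma tens_linear_eq (K : comPzRingType) (V W : lmodType K) n (f g : tens V n -> W) :
  linear f -> linear g -> (forall u, f (tpure u) = g (tpure u)) -> f =1 g.
Proof.
move=> lf lg fg t; have [s [c ->]] := tens_span t.
rewrite (linear_of_sum lf) (linear_of_sum lg); apply: eq_bigr => u _.
by rewrite (linear_of_Z lf) (linear_of_Z lg) fg.
Qed.

Section Cons.
Variables (K : comPzRingType) (V : lmodType K).

Definition fcons l (x : V) (u : {ffun 'I_l -> V}) : {ffun 'I_l.+1 -> V} :=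
  [ffun i => if unlift ord0 i is Some j then u j else x].

Lemma fcons0 l x (u : {ffun 'I_l -> V}) : fcons x u ord0 = x.
Proof. by rewrite ffunE unlift_none. Qed.

Lemma fconsS l x (u : {ffun 'I_l -> V}) j : fcons x u (lift ord0 j) = u j.
Proof. by rewrite ffunE liftK. Qed.

Lemma fcons_behead l x (u : {ffun 'I_l -> V}) :
  [ffun j => fcons x u (lift ord0 j)] = u.
Proof. by apply/ffunP => j; rewrite ffunE fconsS. Qed.

Definition tcons l (x : V) (t : tens V l) : tens V l.+1 :=
  @tcat K V 1 l (tpure [ffun=> x]) t.

Lemma tcons_linear l x : linear (@tcons l x).
Proof. exact: (@tcat_linear_r K V 1 l). Qed.

Lemma tcons_pure l x (u : {ffun 'I_l -> V}) : tcons x (tpure u) = tpure (fcons x u).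
Proof.
rewrite /tcons tcat_pure; congr tpure; apply/ffunP => i.
rewrite /fcons /ffcat (ffunE _ i) [RHS](ffunE _ i).
case: (@split_ordP 1 l i) => j ->.
  by rewrite ffunE (_ : lshift l j = ord0) ?unlift_none // [j]ord1; apply: val_inj.
by rewrite (_ : rshift 1 j = lift ord0 j) ?liftK //; apply: val_inj.
Qed.

Lemma tcat_tpair (x y : V) l (t : tens V l) :
  tcat (tpair x y) t = tcons x (tcons y t).
Proof.
move: t; apply: tens_linear_eq => [||u]; first exact: tcat_linear_r.
  exact: linear_comp (tcons_linear x) (tcons_linear y).
rewrite !tcons_pure tcat_pure; congr tpure; apply/ffunP => i.
rewrite /ffcat (ffunE _ i); case: (@split_ordP 2 l i) => j ->.
  rewrite ffunE; case: j => [[|[|//]] j2] /=.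
    by rewrite (_ : @lshift 2 l _ = ord0 :> 'I_(2 + l)) ?fcons0 //; apply: val_inj.
  rewrite (_ : @lshift 2 l _ = lift ord0 ord0 :> 'I_(2 + l)) ?fconsS ?fcons0 //.
  exact: val_inj.
rewrite (_ : @rshift 2 l j = lift ord0 (lift ord0 j) :> 'I_(2 + l)) ?fconsS //.
exact: val_inj.
Qed.
End Cons.

Lemma coprod_first_tcons (K : comPzRingType) (A : lmodType K) (x : FA A) l
    (t : tens (FA A) l) :
  coprod_first (tcons x t) = tcat (coprod x) t.
Proof.
move: t; apply: tens_linear_eq => [||u]; last first.
- by rewrite tcons_pure coprod_first_pure fcons0 fcons_behead.
- by move=> c a b; rewrite tcat_linear_r.
- by move=> c a b; rewrite tcons_linear coprod_first_linear.
Qed.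

(** Reindexes pairs j <= k by i = k - j, to compare cutting a prefix again with cutting the
    suffix. *)
Lemma triangle_sum (V : nmodType) n (F : nat -> nat -> V) :
  \sum_(k < n.+1) \sum_(j < k.+1) F j (k - j)%N
  = \sum_(j < n.+1) \sum_(i < (n - j).+1) F j i.
Proof.
transitivity (\sum_(0 <= k < n.+1) \sum_(0 <= j < n.+1 | (j <= k)%N) F j (k - j)%N).
  rewrite big_mkord; apply: eq_bigr => k _.
  rewrite -(big_mkord xpredT (fun j => F j (k - j)%N)) (big_nat_widen 0 k.+1 n.+1) //.
rewrite (exchange_big_dep_nat xpredT) //= big_mkord; apply: eq_bigr => j _.
rewrite -(big_mkord xpredT (F j)) -subSn; last by rewrite -ltnS.
under [RHS]eq_bigr => i _ do rewrite -[X in F j X](addnK j).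
by rewrite -(big_addn 0 _ j xpredT (fun i => F j (i - j)%N)) [RHS](big_nat_widenl _ 0).
Qed.

Lemma tcat_suml (K : comPzRingType) (V : lmodType K) n m (I : Type) (r : seq I)
    (P : pred I) (F : I -> tens V n) (t : tens V m) :
  tcat (\sum_(i <- r | P i) F i) t = \sum_(i <- r | P i) tcat (F i) t.
Proof. exact: linear_of_sum (tcat_linear_l t) _ _ _ _. Qed.

Lemma tcons_sum (K : comPzRingType) (V : lmodType K) n (I : Type) (r : seq I)
    (P : pred I) (F : I -> tens V n) (x : V) :
  tcons x (\sum_(i <- r | P i) F i) = \sum_(i <- r | P i) tcons x (F i).
Proof. exact: linear_of_sum (tcons_linear x) _ _ _ _. Qed.

(** * The iterated coproduct of a word *)

Section IteratedCoproduct.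
Variables (K : comPzRingType) (A : lmodType K).
Implicit Types (b : nat -> A) (w : nat -> nat).

Lemma iter_coprodS l (y : FA A) : iter_coprod l.+1 y = coprod_first (iter_coprod l y).
Proof. by []. Qed.

Lemma iter_coprod0 (y : FA A) :
  iter_coprod 0 y = tcons y (tpure [ffun i : 'I_0 => 0]).
Proof.
by rewrite tcons_pure; congr tpure; apply/ffunP => i; rewrite ffunE ord1 fcons0.
Qed.

Lemma iter_coprod_linear l : linear (@iter_coprod K A l).
Proof.
elim: l => [|l IH]; last exact: linear_comp (@coprod_first_linear _ _ _) IH.
have E (y : FA A) : iter_coprod 0 y = tpure (ffset [ffun=> 0] ord0 y).
  by congr tpure; apply/ffunP => i; rewrite !ffunE ord1.
by move=> c x y; rewrite !E; exact: tpure_multilinear.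
Qed.

Lemma coprod_first_word l n b w (t : tens (FA A) l) :
  coprod_first (tcons (word n b w) t)
  = \sum_(k < n.+1) tcons (word k b w)
     (tcons (word (n - k) (fun j => b (k + j)%N) (fun j => w (k + j)%N)) t).
Proof.
rewrite coprod_first_tcons coprod_word tcat_suml.
by apply: eq_bigr => k _; rewrite tcat_tpair.
Qed.

(** The definition keeps splitting the first factor; here the remaining factors come from the suffix
    instead, which suits an induction that peels off the first factor. *)
Lemma iter_coprod_word l n b w :
  iter_coprod l.+1 (word n b w)
  = \sum_(k < n.+1) tcons (word k b w)
     (iter_coprod l (word (n - k) (fun j => b (k + j)%N) (fun j => w (k + j)%N))).
Proof.
elim: l n b w => [|l IH] n b w.
  rewrite iter_coprodS [iter_coprod 0 _]iter_coprod0 coprod_first_word.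
  by apply: eq_bigr => k _; rewrite iter_coprod0.
rewrite iter_coprodS IH.
rewrite (linear_of_sum (@coprod_first_linear _ _ _)).
pose F j i := tcons (word j b w) (tcons
  (word i (fun h => b (j + h)%N) (fun h => w (j + h)%N))
  (iter_coprod l (word (n - (j + i))
    (fun h => b (j + i + h)%N) (fun h => w (j + i + h)%N)))).
have FE (T : Type) (f : nat -> T) j i :
    (fun h => f (j + (i + h))%N) = (fun h => f (j + i + h)%N).
  by apply: funext => h; rewrite addnA.
(* coassociativity: cut at [k] then at [j <= k], or at [j] then beyond *)
transitivity (\sum_(k < n.+1) \sum_(j < k.+1) F j (k - j)%N).
  apply: eq_bigr => k _; rewrite coprod_first_word; apply: eq_bigr => j _.
  by rewrite /F subnKC // -ltnS.
rewrite triangle_sum; apply: eq_bigr => k _.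
rewrite IH tcons_sum; apply: eq_bigr => j _.
by rewrite /F subnDA !FE.
Qed.
End IteratedCoproduct.

(** * Coinvariants and the splitting formula *)

Section Coinvariants.
Variables (K : comPzRingType) (A : algType K).
Implicit Types (b : nat -> A) (w : nat -> nat) (z : FA A).
Implicit Types (D E : (nat -> A) -> (nat -> nat) -> FA A).

Lemma iprod_in n (f : Fn A n) z : iprod (inF f) z = inF (iprod_n f (z n)).
Proof.
rewrite /iprod {1}/inF dsum_lift_in // => m.
by rewrite (linear_of_0 (iprod_n_linear_l _)); exact: inF0.
Qed.

Lemma iprod_pure_hash_neq n m b a (s : 'S_n) (g : 'S_m) : n != m ->
  iprod (pure_hash b s) (pure_hash a g : FA A) = 0.
Proof.
move=> nm; rewrite /pure_hash iprod_in [X in iprod_n _ X](word_coef a g nm).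
by rewrite (linear_of_0 (iprod_n_linear_r _)); exact: inF0.
Qed.

Lemma iprod_pure_hash n b a (s g : 'S_n) :
  iprod (pure_hash b s) (pure_hash a g : FA A)
  = pure_hash (fun j => b j * a (permn s j)) (s * g)%g.
Proof.
rewrite /pure_hash iprod_in {2}/inF /= dfwith_in iprod_n_hash.
congr (inF (hash (tpure _) _)); last by rewrite /scomp invMg.
by apply/ffunP => i; rewrite !ffunE invgK permnE.
Qed.

(* Only the first [n] terms of the sequences matter to a word of length [n]. *)
Definition mlin n E :=
  forall w b i, (i < n)%N -> linear (fun v => E (upd b i v) w).

Definition permute n (g : 'S_n) E b w :=
  E (fun j => b (permn g j)) (fun j => w (permn g j)).

Lemma mlin_permute n (g : 'S_n) E : mlin n E -> mlin n (permute g E).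
Proof.
move=> mE w b i ilt c u v; rewrite /permute !upd_permn //.
by rewrite mE // permn_lt.
Qed.

(** Functions of a word that vanish on invariant families; the two sides of the formula are compared
    modulo these. Scalars are absorbed by [E], so closure under sums suffices. *)
Inductive coinv n : ((nat -> A) -> (nat -> nat) -> FA A) -> Prop :=
| coinv0 : coinv n (fun _ _ => 0)
| coinvD D D' : coinv n D -> coinv n D' -> coinv n (fun b w => D b w + D' b w)
| coinv_gen E (g : 'S_n) : mlin n E -> coinv n (fun b w => permute g E b w - E b w).

Lemma coinv_ext n D D' : (forall b w, D b w = D' b w) -> coinv n D -> coinv n D'.
Proof.
by move=> DD; rewrite (_ : D = D') //; apply: funext => b; apply: funext => w.
Qed.

Lemma coinv_map n (f : FA A -> FA A) D :
  linear f -> coinv n D -> coinv n (fun b w => f (D b w)).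
Proof.
move=> lf; elim=> [|{}D D' _ ID _ ID'|E g mE].
- by apply: coinv_ext (coinv0 n) => b w; rewrite (linear_of_0 lf).
- by apply: coinv_ext (coinvD ID ID') => b w; rewrite (linear_of_D lf).
have mfE : mlin n (fun b w => f (E b w)).
  by move=> w b i ilt c u v; rewrite mE // lf.
apply: coinv_ext (coinv_gen g mfE) => b w.
by rewrite (linear_of_B lf).
Qed.

Lemma scale_linear (c : K) : linear (fun x : FA A => c *: x).
Proof. by move=> d x y; rewrite scalerDr !scalerA mulrC. Qed.

Lemma coinv_linear n c D D' :
  coinv n D -> coinv n D' -> coinv n (fun b w => c *: D b w + D' b w).
Proof. by move=> /(coinv_map (scale_linear c)) DC; exact: coinvD. Qed.

Lemma coinv_sum n (I : Type) (r : seq I) (P : pred I)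
    (F : I -> (nat -> A) -> (nat -> nat) -> FA A) :
  (forall i, P i -> coinv n (F i)) -> coinv n (fun b w => \sum_(i <- r | P i) F i b w).
Proof.
move=> FC; elim: r => [|i r IH].
  by apply: coinv_ext (coinv0 n) => b w; rewrite big_nil.
case Pi: (P i).
  by apply: coinv_ext (coinvD (FC i Pi) IH) => b w; rewrite big_cons Pi.
by apply: coinv_ext IH => b w; rewrite big_cons Pi.
Qed.

(** Each tensor factor occurs in the prefix or in the suffix, never in both. *)
Lemma mlin_word_prod n k z D : (k <= n)%N -> mlin (n - k) D ->
  mlin n (fun b w => eprod (iprod (word k b w) z)
                       (D (fun j => b (k + j)%N) (fun j => w (k + j)%N))).
Proof.
move=> kn mD w b i ilt c u v; case: (ltnP i k) => ik.
  have E x : (fun j => upd b i x (k + j)%N) = (fun j => b (k + j)%N).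
    by apply: funext => j; rewrite /upd ifN // gtn_eqF //; lia.
  by rewrite !E /word pure_hash_linear // iprod_linear_l eprod_linear_l.
have E x : word k (upd b i x) w = word k b w.
  by apply: word_eq => // j jk; rewrite /upd ifN // ltn_eqF //; lia.
have E' x : (fun j => upd b i x (k + j)%N) = upd (fun j => b (k + j)%N) (i - k)%N x.
  apply: funext => j; rewrite /upd; congr (if _ then _ else _).
  by apply/eqP/eqP; lia.
by rewrite !E !E' mD ?eprod_linear_r // ltn_sub2r //; lia.
Qed.

(** A permutation of the suffix extends to the whole word by fixing the prefix, so a difference in
    the suffix is a difference for the whole word. *)
Lemma coinv_word_prod n k z D : (k <= n)%N -> coinv (n - k) D ->
  coinv n (fun b w => eprod (iprod (word k b w) z)
                        (D (fun j => b (k + j)%N) (fun j => w (k + j)%N))).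
Proof.
move=> kn; elim=> [|{}D D' _ ID _ ID'|E g mE].
- by apply: coinv_ext (coinv0 n) => b w; rewrite (linear_of_0 (eprod_linear_r _)).
- apply: coinv_ext (coinvD ID ID') => b w.
  by rewrite (linear_of_D (eprod_linear_r _)).
have := mlin_word_prod z kn mE.
pose h : 'S_(k + (n - k)) := juxt 1%g g.
(* Transport from length [k + (n - k)] to [n], remembering only the action on indices. *)
have [h' h'E] : exists h' : 'S_n, permn h' =1 permn h.
  by move: h; rewrite subnKC // => h; exists h.
move=> /(coinv_gen h'); apply: coinv_ext => b w.
rewrite (linear_of_B (eprod_linear_r (iprod (word k b w) z))).
have permE (T : Type) (f : nat -> T) :
    (fun j => f (permn h' (k + j)))%N = (fun j => f (k + permn g j)%N).
  by apply: funext => j; rewrite h'E permn_juxt_addl.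
have wE : word k (fun j => b (permn h' j)) (fun j => w (permn h' j)) = word k b w.
  by apply: word_eq => j jk; rewrite h'E permn_juxt_lt // permn1.
by rewrite /permute wE !permE.
Qed.

End Coinvariants.

Section Splitting.
Variables (K : comPzRingType) (A : algType K).
Implicit Types (b : nat -> A) (w : nat -> nat) (y z : FA A).

Lemma coinv_gen_sum n (I : Type) (r : seq I) (P : pred I) (g : I -> 'S_n)
    (E : I -> (nat -> A) -> (nat -> nat) -> FA A) :
  (forall i, P i -> mlin n (E i)) ->
  coinv n (fun b w => \sum_(i <- r | P i) permute (g i) (E i) b w
                      - \sum_(i <- r | P i) E i b w).
Proof.
move=> mE; apply: (@coinv_ext K A n
  (fun b w => \sum_(i <- r | P i) (permute (g i) (E i) b w - E i b w))).
  by move=> b w; rewrite big_split sumrN.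
by apply: coinv_sum => i Pi; apply/coinv_gen/mE.
Qed.

(** The right-hand side of the formula for two factors, evaluated at a single word. *)
Definition cut_prod n z z' b w : FA A :=
  \sum_(k < n.+1) eprod (iprod (word k b w) z)
    (iprod (word (n - k) (fun j => b (k + j)%N) (fun j => w (k + j)%N)) z').

Definition word_block_std p q w : 'S_(p + q) := block_std (fun i : 'I_(p + q) => w i).

(** Factor [x * stdn (p + q) w] into block part and shuffle. As [x] is increasing on the blocks,
    [std_sub] computes the block part from [w] directly. *)
Lemma word_block_std_shuffle p q w (x : 'S_(p + q)) : x \in shuffles p q ->
  (stdn (p + q) w * (shuffle_rep (x * stdn (p + q) w))^-1
   = x^-1 * word_block_std p q (fun j => w (permn x j)))%g.
Proof.
move=> xS; rewrite /shuffle_rep !invMg invgK !mulgA mulgV mul1g; congr (_ * juxt _ _)%g.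
  transitivity (std (fun i => w (x (lshift q i)))).
    rewrite -(@std_sub _ _ (fun i : 'I_(p + q) => w i) (fun i => x (lshift q i))).
      by congr std; apply: funext => i; rewrite permM.
    by move=> i j; exact: shuffles_lshift.
  by congr std; apply: funext => i; rewrite -permnE.
transitivity (std (fun i => w (x (rshift p i)))).
  rewrite -(@std_sub _ _ (fun i : 'I_(p + q) => w i) (fun i => x (rshift p i))).
    by congr std; apply: funext => i; rewrite permM.
  by move=> i j; exact: shuffles_rshift.
by congr std; apply: funext => i; rewrite -permnE.
Qed.

(** Both terms are sums over shuffles [x]: [cut_prod] of [permute x^-1 (F x)], and the internal
    product of [F x] after reindexing. They thus differ by generators of [coinv]. *)
Lemma coinv_cut_prod_pure p q a a' (s : 'S_p) (s' : 'S_q) :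
  coinv (p + q) (fun b w =>
    cut_prod (p + q) (pure_hash a s) (pure_hash a' s') b w
    - iprod (word (p + q) b w) (eprod (pure_hash a s) (pure_hash a' s'))).
Proof.
(* [E g b] is the internal product of [pure_hash b g] with the juxtaposition of the two right
   factors. *)
pose aa := ncat p a a'; pose E (g : 'S_(p + q)) b : FA A :=
  pure_hash (fun j => b j * aa (permn g j)) (g * juxt s s')%g.
pose F (x : 'S_(p + q)) b w := E (x^-1 * word_block_std p q (fun j => w (permn x j)))%g b.
have mF x : mlin (p + q) (F x).
  move=> w b i ilt c u v; rewrite /F /E.
  set g := (_ * _)%g.
  have L d : (fun j => upd b i d j * aa (permn g j))
     = upd (fun j => b j * aa (permn g j)) i (d * aa (permn g i)).
    by apply: funext => j; rewrite /upd; case: eqP => // ->.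
  by rewrite !L mulrDl -scalerAl pure_hash_linear.
apply: coinv_ext (coinv_gen_sum (index_enum _) (fun x => x^-1%g)
  (fun x (_ : x \in shuffles p q) => mF x)).
move=> b w; congr (_ - _); apply: esym.
  (* Only the cut at [p] gives a prefix of the degree of the first right factor. *)
  have pq : (p < (p + q).+1)%N by rewrite ltnS leq_addr.
  rewrite /cut_prod (bigD1 (Ordinal pq)) //= big1 ?addr0; last first.
    move=> k neq; have kp : k != p :> nat.
      by apply: contra neq => /eqP e; apply/eqP/val_inj.
    by rewrite iprod_pure_hash_neq // (linear_of_0 (eprod_linear_l _)).
  rewrite addKn !iprod_pure_hash eprod_pure_hash; apply: eq_bigr => x _.
  have wx : (fun j => w (permn x^-1%g (permn x j))) = w.
    by apply: funext => j; rewrite -permnM mulgV permn1.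
  rewrite /permute /F /E wx -mulgA juxtM; congr pure_hash.
  apply: funext => j; rewrite permnM.
  move: (permn x^-1%g j) => {}j; rewrite /aa -[LHS]/(ncat p _ _ j).
  have := congr1 (fun f => f j) (ncat_permn (stdn p w) (stdn q (fun j => w (p + j)%N)) a a').
  rewrite /word_block_std /block_std -/(stdn p w) => <-.
  rewrite /ncat; case: ifP => // jp; congr (b _ * _); lia.
rewrite eprod_pure_hash (linear_of_sum (iprod_linear_r _)).
(* Replace each shuffle [x] by the shuffle in the coset of [x * stdn (p + q) w]; the word [w] is
   fixed here, so the reindexing may depend on it. *)
rewrite -(sum_shuffle_rep _ (stdn (p + q) w)); apply: eq_bigr => x xS.
rewrite iprod_pure_hash /F /E -(word_block_std_shuffle w xS) -mulgA; congr pure_hash.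
by apply: funext => j; rewrite permnM.
Qed.

Lemma coinv_cut_prod n z z' :
  coinv n (fun b w => cut_prod n z z' b w - iprod (word n b w) (eprod z z')).
Proof.
elim/FA_ind: z => [|c y z IHy IHz|p a s].
- apply: coinv_ext (coinv0 A n) => b w.
  rewrite /cut_prod big1 => [|k _].
    by rewrite (linear_of_0 (eprod_linear_l _)) (linear_of_0 (iprod_linear_r _)) subr0.
  by rewrite (linear_of_0 (iprod_linear_r _)) (linear_of_0 (eprod_linear_l _)).
- apply: coinv_ext (coinv_linear c IHy IHz) => b w.
  rewrite eprod_linear_l iprod_linear_r scalerBr opprD addrACA; congr (_ + _).
  rewrite /cut_prod scaler_sumr -big_split; apply: eq_bigr => k _.
  by rewrite iprod_linear_r eprod_linear_l.
elim/FA_ind: z' => [|c y z IHy IHz|q a' s'].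
- apply: coinv_ext (coinv0 A n) => b w.
  rewrite /cut_prod big1 => [|k _].
    by rewrite (linear_of_0 (eprod_linear_r _)) (linear_of_0 (iprod_linear_r _)) subr0.
  by rewrite (linear_of_0 (iprod_linear_r _)) (linear_of_0 (eprod_linear_r _)).
- apply: coinv_ext (coinv_linear c IHy IHz) => b w.
  rewrite eprod_linear_r iprod_linear_r scalerBr opprD addrACA; congr (_ + _).
  rewrite /cut_prod scaler_sumr -big_split; apply: eq_bigr => k _.
  by rewrite iprod_linear_r eprod_linear_r.
case: (eqVneq n (p + q)%N) => [->|npq]; first exact: coinv_cut_prod_pure.
apply: coinv_ext (coinv0 A n) => b w.
rewrite eprod_pure_hash (linear_of_sum (iprod_linear_r _)) [X in _ - X]big1.
  rewrite subr0 /cut_prod big1 // => k _.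
  case: (eqVneq (k : nat) p) => [kp|kp].
    rewrite [X in eprod _ X]iprod_pure_hash_neq ?(linear_of_0 (eprod_linear_r _)) //.
    by have := ltn_ord k; lia.
  by rewrite [X in eprod X _]iprod_pure_hash_neq ?(linear_of_0 (eprod_linear_l _)).
by move=> x _; exact: iprod_pure_hash_neq.
Qed.

Definition sweedler l (z : 'I_l -> FA A) (t : tens (FA A) l) : FA A :=
  tlift (fun u : {ffun 'I_l -> FA A} =>
    \big[@eprod K A/eone A]_(i < l) iprod (u i) (z i)) t.

Lemma sweedler_linear l (z : 'I_l -> FA A) : linear (sweedler z).
Proof. exact/tlift_linear/sweedler_multilinear. Qed.

Lemma sweedler_pure l (z : 'I_l -> FA A) u :
  sweedler z (tpure u) = \big[@eprod K A/eone A]_(i < l) iprod (u i) (z i).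
Proof. exact/tlift_pure/sweedler_multilinear. Qed.

Lemma sweedler_tcons l (z : 'I_l.+1 -> FA A) y t :
  sweedler z (tcons y t)
  = eprod (iprod y (z ord0)) (sweedler (fun i => z (lift ord0 i)) t).
Proof.
move: t; apply: tens_linear_eq => [||u].
- exact: linear_comp (sweedler_linear z) (tcons_linear y).
- exact: linear_comp (eprod_linear_r _) (sweedler_linear _).
rewrite tcons_pure !sweedler_pure big_ord_recl fcons0.
by congr eprod; apply: eq_bigr => i _; rewrite fconsS.
Qed.

(** Induction on [l]: cut off the first factor, replace the rest by its internal product with [Z]
    modulo [coinv], then apply the two-factor formula to [z ord0] and [Z]. *)
Lemma coinv_sweedler n l (z : 'I_l.+1 -> FA A) :
  coinv n (fun b w => sweedler z (iter_coprod l (word n b w))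
             - iprod (word n b w) (\big[@eprod K A/eone A]_(i < l.+1) z i)).
Proof.
elim: l n z => [|l IH] n z.
  apply: coinv_ext (coinv0 A n) => b w.
  rewrite iter_coprod0 sweedler_tcons sweedler_pure !(big_ord_recl, big_ord0).
  by rewrite !eprodr1 subrr.
rewrite big_ord_recl; set Z := \big[_/_]_(i < _) _.
pose D m b w := sweedler (fun i => z (lift ord0 i)) (iter_coprod l (word m b w))
  - iprod (word m b w) Z.
have C : coinv n (fun b w => \sum_(k < n.+1) eprod (iprod (word k b w) (z ord0))
   (D (n - k)%N (fun j => b (k + j)%N) (fun j => w (k + j)%N))).
  apply: coinv_sum => k _; apply: (@coinv_word_prod K A n k (z ord0) (D (n - k)%N)).
    by rewrite -ltnS.
  exact: IH.
apply: coinv_ext (coinvD C (coinv_cut_prod n (z ord0) Z)) => b w.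
rewrite iter_coprod_word (linear_of_sum (sweedler_linear z)) addrA; congr (_ - _).
rewrite /cut_prod -big_split; apply: eq_bigr => k _ /=.
by rewrite (linear_of_B (eprod_linear_r _)) subrK sweedler_tcons.
Qed.

End Splitting.

(** * Invariant families *)

Section Symmetric.
Variables (K : comPzRingType) (A : algType K).
Implicit Types (y z : FA A) (E D : (nat -> A) -> (nat -> nat) -> FA A).
Implicit Types s : seq (K * ((nat -> A) * (nat -> nat))).

(** The list [s] is a formal sum; each entry holds a coefficient, the tensor factors and the
    letters. *)
Definition eval s E : FA A := \sum_(p <- s) p.1 *: E p.2.1 p.2.2.

(* Invariance of the formal sum [s] in (tensors) @ (words), expressed through all
   maps out of it; this replaces symmetric tensors with letters. *)
Definition invariant n s :=
  forall E (g : 'S_n), mlin n E -> eval s (permute g E) = eval s E.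

Lemma eval_coinv n s D : invariant n s -> coinv n D -> eval s D = 0.
Proof.
move=> sI; elim=> [|{}D D' _ ID _ ID'|E g mE].
- by rewrite /eval big1 // => p _; rewrite scaler0.
- rewrite -[RHS]addr0 -{1}ID -ID' /eval -big_split.
  by apply: eq_bigr => p _; rewrite scalerDr.
transitivity (eval s (permute g E) - eval s E); last by rewrite sI // subrr.
by rewrite /eval -sumrB; apply: eq_bigr => p _; rewrite scalerBr.
Qed.

Inductive invariant_span : FA A -> Prop :=
| invariant_span0 : invariant_span 0
| invariant_span_cons c n s y : invariant n s -> invariant_span y ->
    invariant_span (c *: eval s (word n) + y).

Lemma invariant_spanL c y z :
  invariant_span y -> invariant_span z -> invariant_span (c *: y + z).
Proof.
move=> yS zS; elim: yS => [|d n s {}y sI _ IH]; first by rewrite scaler0 add0r.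
by rewrite scalerDr -addrA scalerA; exact: invariant_span_cons.
Qed.

Lemma mlin_zero_ext n E w : mlin n E ->
  multilinear (fun a : {ffun 'I_n -> A} => E (zero_ext a) w).
Proof.
move=> mE a i; have L v : zero_ext (ffset a i v) = upd (zero_ext a) i v.
  apply: funext => j; rewrite /zero_ext /upd.
  case: insubP => [h _ <-|]; first by rewrite ffunE.
  by case: eqP => // ->; rewrite ltn_ord.
by move=> c u v; rewrite !L mE.
Qed.

Lemma zero_ext_permn n (g : 'S_n) (a : {ffun 'I_n -> A}) :
  (fun j => zero_ext a (permn g j)) = zero_ext [ffun i => a (g i)].
Proof.
apply: funext => j; case: (ltnP j n) => jn; last first.
  by rewrite permn_ge // /zero_ext insubF // ltnNge jn.
pose i := Ordinal jn.
by rewrite (permnE g i) /zero_ext (valK (g i)) (valK i) ffunE.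
Qed.

(** Take all letters equal: the word standardizes to the identity, and permuting it moves the tensor
    factors only. *)
Lemma invariant_span_symmetric n (t : tens A n) :
  symmetric_tensor t -> invariant_span (inF (hash t 1%g)).
Proof.
move=> tS; have [r [c tE]] := tens_span t.
pose s := [seq (c a, (zero_ext a, fun _ : nat => 0%N)) | a : {ffun 'I_n -> A} <- r].
(* Evaluation thus depends on [t] alone, not on the chosen sum of pure tensors. *)
have evE E : mlin n E -> eval s E = tlift (fun a => E (zero_ext a) (fun=> 0%N)) t.
  move=> mE; have L := tlift_linear (mlin_zero_ext (fun=> 0%N) mE).
  rewrite tE (linear_of_sum L) /eval big_map; apply: eq_bigr => a _.
  by rewrite (linear_of_Z L) tlift_pure //; exact: mlin_zero_ext.
have -> : inF (hash t 1%g) = 1 *: eval s (word n) + 0.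
  have L : linear (fun t => inF (hash t 1%g)) :=
    linear_comp (@inF_linear _ A n) (hash_linear 1%g).
  rewrite scale1r addr0 tE (linear_of_sum L) /eval big_map; apply: eq_bigr => a _.
  rewrite (linear_of_Z L); congr (_ *: inF (hash (tpure _) _)).
    by rewrite ffun_zero_ext.
  rewrite -invg1 -std_id; congr (_^-1)%g; apply: std_eq => i j; rewrite /std_lt /=.
  by case: ltngtP.
apply: invariant_span_cons invariant_span0 => E g mE.
have mgE := mlin_permute g mE.
rewrite (evE _ mE) (evE _ mgE) -{2}(tS g^-1%g).
have L := tlift_linear (mlin_zero_ext (fun=> 0%N) mE).
move: {tE evE tS} t; apply: tens_linear_eq => [||a].
- exact: tlift_linear (mlin_zero_ext _ mgE).
- exact: linear_comp L (tact_linear _).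
rewrite tact_pure !tlift_pure; try exact: mlin_zero_ext.
by rewrite /permute zero_ext_permn invgK.
Qed.

Lemma mlin_ncat_l n m E b' w' : mlin (n + m) E ->
  mlin n (fun b w => E (ncat n b b') (ncat n w w')).
Proof.
move=> mE w b i ilt c u v.
have L x : ncat n (upd b i x) b' = upd (ncat n b b') i x.
  apply: funext => j; rewrite /ncat /upd; case: ltnP => // jn.
  by rewrite ifN // gtn_eqF //; exact: leq_trans jn.
by rewrite !L mE //; exact: leq_trans (leq_addr _ _).
Qed.

Lemma mlin_ncat_r n m E b w k : mlin (n + m) E ->
  mlin m (fun b' w' => E (ncat n b b') (ncat n w (fun i => k + w' i)%N)).
Proof.
move=> mE w' b' i ilt c u v.
have L x : ncat n b (upd b' i x) = upd (ncat n b b') (n + i)%N x.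
  apply: funext => j; rewrite /ncat /upd; case: ltnP => jn.
    by rewrite ifN // ltn_eqF //; exact: leq_trans (leq_addr _ _).
  by rewrite -(eqn_add2l n) subnKC.
by rewrite !L mE // ltn_add2l.
Qed.

(** [juxt g g'] acts on the two words separately, so invariance of [s'] and then of [s] removes
    it. *)
Lemma invariant_juxt n m s s' k E (g : 'S_n) (g' : 'S_m) :
  invariant n s -> invariant m s' -> mlin (n + m) E ->
  \sum_(p <- s) p.1 *: \sum_(q <- s') q.1 *:
    permute (juxt g g') E (ncat n p.2.1 q.2.1) (ncat n p.2.2 (fun i => k + q.2.2 i)%N)
  = \sum_(p <- s) p.1 *: \sum_(q <- s') q.1 *:
    E (ncat n p.2.1 q.2.1) (ncat n p.2.2 (fun i => k + q.2.2 i)%N).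
Proof.
move=> sI s'I mE.
have pE b b' w w' : permute (juxt g g') E (ncat n b b') (ncat n w (fun i => k + w' i)%N)
   = E (ncat n (fun j => b (permn g j)) (fun j => b' (permn g' j)))
      (ncat n (fun j => w (permn g j)) (fun j => k + w' (permn g' j))%N).
  by rewrite /permute (ncat_permn g g') -(ncat_permn g g' w).
transitivity (eval s (permute g (fun b w => \sum_(q <- s') q.1 *:
    E (ncat n b q.2.1) (ncat n w (fun i => k + q.2.2 i)%N)))).
  apply: eq_bigr => p _; congr (_ *: _).
  under eq_bigr => q _ do rewrite pE.
  exact: (s'I _ g' (mlin_ncat_r
    (fun j => p.2.1 (permn g j)) (fun j => p.2.2 (permn g j)) k mE)).
apply: sI => w b i ilt; apply: linear_bigsum => q c u v.
by rewrite (mlin_ncat_l _ _ mE) // scalerDr !scalerA mulrC.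
Qed.

Definition letters_below n k (p : K * ((nat -> A) * (nat -> nat))) : bool :=
  [forall i : 'I_n, (p.2.2 i < k)%N].

(** Supplies one shift for [eprod_word] that works for all words of the family. *)
Lemma letter_bound n s : exists k, all (letters_below n k) s.
Proof.
elim: s => [|p s [k sk]]; first by exists 0%N.
exists (maxn (\max_(i < n) p.2.2 i).+1 k) => /=; apply/andP; split.
  by apply/forallP => i; rewrite leq_max ltnS leq_bigmax.
apply: sub_all sk => q /forallP qk; apply/forallP => i.
by rewrite leq_max [X in _ || X]qk orbT.
Qed.

(** The family [ss] of all shuffled concatenations is invariant: [g] permutes the shuffles up to
    elements of S_n x S_m, which [invariant_juxt] absorbs. *)
Lemma invariant_span_eval_eprod n m s s' :
  invariant n s -> invariant m s' ->
  invariant_span (eprod (eval s (word n)) (eval s' (word m))).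
Proof.
move=> sI s'I; have [k sk] := letter_bound n s.
pose T (x : 'S_(n + m)) 
    (pq : (K * ((nat -> A) * (nat -> nat))) * (K * ((nat -> A) * (nat -> nat)))) :=
  (pq.1.1 * pq.2.1, (fun j => ncat n pq.1.2.1 pq.2.2.1 (permn x^-1%g j),
    fun j => ncat n pq.1.2.2 (fun i => k + pq.2.2.2 i)%N (permn x^-1%g j))).
pose ss := [seq T x pq | x <- enum (shuffles n m), pq <- [seq (p, q) | p <- s, q <- s']].
have evalE E : eval ss E = \sum_(x in shuffles n m)
    \sum_(p <- s) p.1 *: \sum_(q <- s') q.1 *:
      permute x^-1%g E (ncat n p.2.1 q.2.1) (ncat n p.2.2 (fun i => k + q.2.2 i)%N).
  rewrite /eval big_allpairs_dep big_enum /=; apply: eq_bigr => x _.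
  rewrite big_allpairs_dep; apply: eq_bigr => p _; rewrite scaler_sumr.
  by apply: eq_bigr => q _; rewrite scalerA.
have -> : eprod (eval s (word n)) (eval s' (word m)) = 1 *: eval ss (word (n + m)) + 0.
  rewrite scale1r addr0 evalE exchange_big /= {1}/eval.
  rewrite (linear_of_sum (eprod_linear_l (eval s' (word m)))).
  (* Filtering by a bound that every entry satisfies makes it available under the sum. *)
  rewrite -(all_filterP sk) !big_filter; apply: eq_bigr => p /forallP pk.
  rewrite (linear_of_Z (eprod_linear_l (eval s' (word m)))) -scaler_sumr exchange_big /=.
  congr (_ *: _); rewrite /eval (linear_of_sum (eprod_linear_r (word n p.2.1 p.2.2))).
  apply: eq_bigr => q _; rewrite (linear_of_Z (eprod_linear_r (word n p.2.1 p.2.2))).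
  rewrite -scaler_sumr (@eprod_word _ _ n m k) // => i ilt.
  exact: (pk (Ordinal ilt)).
apply: invariant_span_cons invariant_span0 => E g mE.
rewrite !evalE -[RHS](sum_shuffle_rep _ g^-1%g); apply: eq_bigr => x _.
(* Since [h = B * shuffle_rep h], the total permutation [h^-1] is the inverse shuffle followed by
   [B^-1]. *)
set h := (x * g^-1)%g; pose B := block_std (fun i : 'I_(n + m) => h i).
have permE E' b w : permute x^-1%g (permute g E') b w
    = permute B^-1%g (permute (shuffle_rep h)^-1%g E') b w.
  have fE (U : Type) (f : nat -> U) : (fun j => f (permn x^-1%g (permn g j)))
      = (fun j => f (permn B^-1%g (permn (shuffle_rep h)^-1%g j))).
    apply: funext => j; rewrite -!permnM; congr (f (permn _ j)).
    by rewrite /shuffle_rep -/B -invMg mulKVg /h invMg invgK.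
  by rewrite /permute !fE.
rewrite -(invariant_juxt k (std (fun i => h (lshift m i)))^-1%g
  (std (fun i => h (rshift n i)))^-1%g sI s'I (mlin_permute (shuffle_rep h)^-1%g mE)).
apply: eq_bigr => p _; congr (_ *: _); apply: eq_bigr => q _.
by rewrite permE /B /block_std juxtV.
Qed.

Lemma invariant_span_eprod y z :
  invariant_span y -> invariant_span z -> invariant_span (eprod y z).
Proof.
move=> yS zS; elim: yS => [|c n s {}y sI _ IH].
  by rewrite (linear_of_0 (eprod_linear_l _)); exact: invariant_span0.
rewrite eprod_linear_l; apply: invariant_spanL IH.
elim: zS => [|d m s' {}z s'I _ IH].
  by rewrite (linear_of_0 (eprod_linear_r _)); exact: invariant_span0.
by rewrite eprod_linear_r; apply: invariant_spanL IH; exact: invariant_span_eval_eprod.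
Qed.

Lemma NT_invariant_span y : NT y -> invariant_span y.
Proof.
elim=> [n t tS||c u v _ uS _ vS|u v _ uS _ vS].
- exact: invariant_span_symmetric.
(* The unit lies in degree 0, where there are no factors to permute. *)
- apply: invariant_span_symmetric => g.
  by rewrite tact_pure; congr tpure; apply/ffunP; case.
- exact: invariant_spanL.
- exact: invariant_span_eprod.
Qed.

(** By linearity [y] may be one invariant family of words; on it the difference of the two sides, a
    coinvariant function by [coinv_sweedler], evaluates to zero. *)
Lemma iprod_big_eprod y l (z : 'I_l.+1 -> FA A) : NT y ->
  iprod y (\big[@eprod K A/eone A]_(i < l.+1) z i) = sweedler z (iter_coprod l y).
Proof.
set Z := \big[_/_]_(i < _) _; pose f x := sweedler z (iter_coprod l x).
have L : linear f := linear_comp (sweedler_linear z) (@iter_coprod_linear _ _ l).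
have LZ : linear (fun x => iprod x Z) := iprod_linear_l Z.
move/NT_invariant_span; rewrite -/(f y); elim=> [|c n s {}y sI _ IH].
  by rewrite (linear_of_0 LZ) (linear_of_0 L).
suff e : f (eval s (word n)) = iprod (eval s (word n)) Z by rewrite LZ L IH e.
apply/eqP; rewrite -subr_eq0 /eval (linear_of_sum L) (linear_of_sum LZ) -sumrB.
apply/eqP; rewrite -[RHS](eval_coinv sI (coinv_sweedler n z)).
apply: eq_bigr => p _.
by rewrite (linear_of_Z L) (linear_of_Z LZ) scalerBr.
Qed.

End Symmetric.

Theorem theorem3p4 (K : comPzRingType) (A : algType K) (hA : projective A)
    (y : FA A) (hy : NT y) (l : nat) (z : 'I_l.+1 -> FA A) :
  iprod y (\big[@eprod K A/eone A]_(i < l.+1) z i)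
  = tlift (fun u : {ffun 'I_l.+1 -> FA A} =>
      \big[@eprod K A/eone A]_(i < l.+1) iprod (u i) (z i)) (iter_coprod l y).
Proof. exact: iprod_big_eprod. Qed.
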